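(* For any directed graph $E$ and any field $K$, the following are equivalent: (1) $E$ is all-reflexive; (2) the lattice of graded ideals of $L_K(E)$ is a Boolean algebra.
   Context: $E$ is all-reflexive if: (a) each cycle in $E$ is either without exits or extreme; (b) each vertex emitting infinitely many edges lies on a cycle; (c) for every infinite path $\alpha$ (sequence of edges $e_1e_2\dots$ with $\mathbf{r}(e_n)=\mathbf{s}(e_{n+1})$, vertex set $\alpha^0$), only finitely many edges $e$ satisfy $\mathbf{s}(e)\in\alpha^0$ and $\mathbf{r}(e)\notin R(\alpha^0)$. Here a cycle is a closed path of positive length whose edges have distinct sources; an exit is an edge with source on the cycle not on it; a cycle $c$ is extreme if it has exits and for every path $p$ with $\mathbf{s}(p)\in c^0$ there is a path $q$ from $\mathbf{r}(p)$ to a vertex of $c$; $R(V)=\{u\mid$ there is a path (possibly of length 0) from $u$ to some $v\in V\}$. $L_K(E)$ is the Leavitt path algebra of $E$ over $K$ with its natural $\mathbb{Z}$-grading (degree $n$ spanned by $pq^*$ with $|p|-|q|=n$); an ideal is graded if it is the direct sum of its intersections with the homogeneous components. The graded ideals form a lattice under inclusion. *)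

(* Defs.v *)
From HB Require Import structures.
From mathcomp Require Import all_boot all_order all_algebra.
From Stdlib Require List.
Set Implicit Arguments. Unset Strict Implicit. Unset Printing Implicit Defensive.
Import Order.TTheory GRing.Theory Num.Theory.
Local Open Scope ring_scope.

Section Graph.
Variables (V Ed : Type) (s r : Ed -> V).

Fixpoint chain (v : V) (l : seq Ed) : Prop :=
  match l with [::] => True | e :: l' => s e = v /\ chain (r e) l' end.
Fixpoint pend (v : V) (l : seq Ed) : V :=
  match l with [::] => v | e :: l' => pend (r e) l' end.
Definition reaches (u w : V) : Prop := exists l, chain u l /\ pend u l = w.

Definition is_cycle (c : seq Ed) : Prop :=
  match c with
  | [::] => False
  | e :: _ => chain (s e) c /\ pend (s e) c = s e /\ List.NoDup (map s c)
  end.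
Definition on_cycle (c : seq Ed) (v : V) : Prop := List.In v (map s c).
Definition is_exit (c : seq Ed) (f : Ed) : Prop := on_cycle c (s f) /\ ~ List.In f c.
Definition has_exit (c : seq Ed) : Prop := exists f, is_exit c f.
Definition extreme (c : seq Ed) : Prop :=
  has_exit c /\
  forall (v : V) (l : seq Ed), on_cycle c v -> chain v l ->
    exists w, on_cycle c w /\ reaches (pend v l) w.

Definition finite_pred (T : Type) (P : T -> Prop) : Prop :=
  exists l : seq T, forall x, P x -> List.In x l.
Definition infinite_emitter (v : V) : Prop := ~ finite_pred (fun e => s e = v).

Definition is_inf_path (a : nat -> Ed) : Prop := forall n, r (a n) = s (a n.+1).
Definition inf_path_vertices (a : nat -> Ed) (v : V) : Prop :=
  exists n, s (a n) = v \/ r (a n) = v.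
Definition RR (X : V -> Prop) (u : V) : Prop := exists w, X w /\ reaches u w.

Definition all_reflexive : Prop :=
  (forall c, is_cycle c -> ~ has_exit c \/ extreme c) /\
  (forall v, infinite_emitter v -> exists c, is_cycle c /\ on_cycle c v) /\
  (forall a, is_inf_path a ->
     finite_pred (fun e => inf_path_vertices a (s e) /\
                           ~ RR (inf_path_vertices a) (r e))).
End Graph.

Record nualg (K : fieldType) := NUAlg {
  nua_car :> lmodType K;
  nua_mul : nua_car -> nua_car -> nua_car;
  nua_mulA : forall x y z, nua_mul x (nua_mul y z) = nua_mul (nua_mul x y) z;
  nua_mulDl : forall x y z, nua_mul (x + y) z = nua_mul x z + nua_mul y z;
  nua_mulDr : forall x y z, nua_mul x (y + z) = nua_mul x y + nua_mul x z;
  nua_mulZl : forall (k : K) x y, nua_mul (k *: x) y = k *: nua_mul x y;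
  nua_mulZr : forall (k : K) x y, nua_mul x (k *: y) = k *: nua_mul x y }.

Definition is_alg_hom (K : fieldType) (A B : nualg K) (f : A -> B) : Prop :=
  (forall x y, f (x + y) = f x + f y) /\
  (forall (k : K) x, f (k *: x) = k *: f x) /\
  (forall x y, f (nua_mul x y) = nua_mul (f x) (f y)).

Section Leavitt.
Variables (K : fieldType) (V Ed : Type) (s r : Ed -> V).

Local Unset Implicit Arguments.
Definition leavitt_family (A : nualg K) (P : V -> A) (S St : Ed -> A) : Prop :=
  (forall v, nua_mul (P v) (P v) = P v) /\
  (forall v w, v <> w -> nua_mul (P v) (P w) = 0) /\
  (forall e, nua_mul (P (s e)) (S e) = S e /\ nua_mul (S e) (P (r e)) = S e) /\
  (forall e, nua_mul (P (r e)) (St e) = St e /\ nua_mul (St e) (P (s e)) = St e) /\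
  (forall e, nua_mul (St e) (S e) = P (r e)) /\
  (forall e f, e <> f -> nua_mul (St e) (S f) = 0) /\
  (* (CK2) at regular vertices: s^{-1}(v) finite and nonempty *)
  (forall (v : V) (l : seq Ed), List.NoDup l -> (forall e, s e = v <-> List.In e l) ->
     l <> [::] -> P v = \sum_(e <- l) nua_mul (S e) (St e)).

Definition is_leavitt_path_algebra (A : nualg K) (P : V -> A) (S St : Ed -> A) : Prop :=
  leavitt_family A P S St /\
  forall (B : nualg K) (P' : V -> B) (S' St' : Ed -> B),
    leavitt_family B P' S' St' ->
    (exists f : A -> B, is_alg_hom f /\ (forall v, f (P v) = P' v) /\
        (forall e, f (S e) = S' e) /\ (forall e, f (St e) = St' e)) /\
    (forall f g : A -> B,
        is_alg_hom f -> (forall v, f (P v) = P' v) -> (forall e, f (S e) = S' e) ->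
        (forall e, f (St e) = St' e) ->
        is_alg_hom g -> (forall v, g (P v) = P' v) -> (forall e, g (S e) = S' e) ->
        (forall e, g (St e) = St' e) ->
        forall x, f x = g x).

Local Set Implicit Arguments.
Variables (A : nualg K) (P : V -> A) (S St : Ed -> A).

Fixpoint sp_aux (e : Ed) (l : seq Ed) : A :=
  match l with [::] => S e | f :: l' => nua_mul (S e) (sp_aux f l') end.
Definition spath (v : V) (l : seq Ed) : A :=
  match l with [::] => P v | e :: l' => sp_aux e l' end.
Fixpoint st_aux (e : Ed) (l : seq Ed) : A :=
  match l with [::] => St e | f :: l' => nua_mul (st_aux f l') (St e) end.
Definition sghost (v : V) (l : seq Ed) : A :=
  match l with [::] => P v | e :: l' => st_aux e l' end.

Definition homog (n : int) (x : A) : Prop :=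
  exists (m : nat) (c : 'I_m -> K) (pv qv : 'I_m -> V) (pl ql : 'I_m -> seq Ed),
    (forall i, chain s r (pv i) (pl i) /\ chain s r (qv i) (ql i) /\
               pend r (pv i) (pl i) = pend r (qv i) (ql i) /\
               (size (pl i))%:Z - (size (ql i))%:Z = n) /\
    x = \sum_(i < m) c i *: nua_mul (spath (pv i) (pl i)) (sghost (qv i) (ql i)).

Definition is_ideal (I : A -> Prop) : Prop :=
  I 0 /\ (forall x y, I x -> I y -> I (x + y)) /\
  (forall (k : K) x, I x -> I (k *: x)) /\
  (forall a x, I x -> I (nua_mul a x) /\ I (nua_mul x a)).

Definition is_graded_ideal (I : A -> Prop) : Prop :=
  is_ideal I /\
  forall x, I x -> exists (m : nat) (deg : 'I_m -> int) (y : 'I_m -> A),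
    (forall i, I (y i) /\ homog (deg i) (y i)) /\ x = \sum_(i < m) y i.
End Leavitt.
Arguments leavitt_family {K V Ed} s r A P S St.
Arguments is_leavitt_path_algebra {K V Ed} s r A P S St.


Section Boolean.
Variables (T : Type) (G : (T -> Prop) -> Prop).
Definition psub (X Y : T -> Prop) : Prop := forall x, X x -> Y x.
Definition is_glb (X Y Z : T -> Prop) : Prop :=
  G Z /\ psub Z X /\ psub Z Y /\ forall W, G W -> psub W X -> psub W Y -> psub W Z.
Definition is_lub (X Y Z : T -> Prop) : Prop :=
  G Z /\ psub X Z /\ psub Y Z /\ forall W, G W -> psub X W -> psub Y W -> psub Z W.
Definition is_bot (Z : T -> Prop) : Prop := G Z /\ forall W, G W -> psub Z W.
Definition is_top (Z : T -> Prop) : Prop := G Z /\ forall W, G W -> psub W Z.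

Definition is_boolean_algebra : Prop :=
  (exists Z, is_bot Z) /\ (exists Z, is_top Z) /\
  (forall X Y, G X -> G Y -> (exists Z, is_glb X Y Z) /\ (exists Z, is_lub X Y Z)) /\
  (forall X Y Z J M A1 B1 C, G X -> G Y -> G Z ->
     is_lub Y Z J -> is_glb X J M -> is_glb X Y A1 -> is_glb X Z B1 -> is_lub A1 B1 C ->
     psub M C /\ psub C M) /\
  (forall X, G X -> exists Y, G Y /\
     (forall M, is_glb X Y M -> is_bot M) /\ (forall J, is_lub X Y J -> is_top J)).
End Boolean.

(* Main.v *)
Require Import Defs.
From mathcomp Require Import all_boot all_order all_algebra.
From HB Require Import structures.
From mathcomp Require Import boolp functions.
From Stdlib Require List.
Set Implicit Arguments. Unset Strict Implicit. Unset Printing Implicit Defensive.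
Import Order.TTheory GRing.Theory Num.Theory.
Local Open Scope ring_scope.

(* Both conditions are compared with: every graded ideal X has a graded
   complement Y, that is X /\ Y = 0 and X + Y = L_K(E). Such complements make
   the lattice distributive, because L_K(E) has local units.

   If E is all-reflexive and X is a graded ideal with vertex set H, take for Y
   the ideal generated by the set H' of vertices that do not reach H. A nonzero
   graded ideal contains a vertex, which forces X /\ Y = 0. If X + Y missed a
   vertex, one could build an infinite path outside X + Y that infinitely often
   has an exit into X + Y, contradicting all-reflexivity.

   Conversely, let X be generated by a hereditary set H, let Y be a complement,
   and write a vertex v as i + j with i in X and j in Y. Only finitely many
   paths occur in i, and they end in H; compressing i by a path p from v gives
   0 unless p is comparable with one of them, and then the range of p lies in
   Y, hence does not reach H. Each of the three clauses of all-reflexivity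
   follows from a suitable choice of H. *)

(** * Paths and cycles *)

Section Paths.
Variables (V Ed : Type) (s r : Ed -> V).
Implicit Types (u v w : V) (e f : Ed) (l m : seq Ed).

Lemma chain_cat v l m :
  chain s r v (l ++ m) <-> chain s r v l /\ chain s r (pend r v l) m.
Proof.
by elim: l v => [|e l IH] v /=; [tauto | rewrite IH and_assoc].
Qed.

Lemma pend_cat v l m : pend r v (l ++ m) = pend r (pend r v l) m.
Proof. by elim: l v => //= e l IH v. Qed.

Lemma reaches_refl v : reaches s r v v.
Proof. by exists [::]. Qed.

Lemma reaches_trans v u w : reaches s r u v -> reaches s r v w -> reaches s r u w.
Proof.
move=> [l [cl <-]] [m [cm <-]]; exists (l ++ m).
by rewrite chain_cat pend_cat.
Qed.

Lemma reaches_edge e : reaches s r (s e) (r e).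
Proof. by exists [:: e]. Qed.

Lemma reaches_pend v l : chain s r v l -> reaches s r v (pend r v l).
Proof. by exists l. Qed.

Definition hereditary (H : V -> Prop) : Prop := forall e, H (s e) -> H (r e).

(** This is the form in which the relation (CK2) of [leavitt_family] lists the edges leaving a
    vertex. *)
Definition enumerates v l : Prop := List.NoDup l /\ forall e, s e = v <-> List.In e l.

Definition regular v : Prop := exists2 l, enumerates v l & l <> [::].

Definition saturated (H : V -> Prop) : Prop :=
  forall v, regular v -> (forall e, s e = v -> H (r e)) -> H v.

Lemma hereditary_reaches H v w : hereditary H -> H v -> reaches s r v w -> H w.
Proof.
move=> hH Hv [l [cl <-]]; elim: l v Hv cl => //= e l IH v Hv [sev cl].
by apply: IH cl; apply: hH; rewrite sev.
Qed.

Definition descendants (X : V -> Prop) w : Prop := exists2 v, X v & reaches s r v w.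

Lemma hereditary_descendants X : hereditary (descendants X).
Proof.
by move=> e [v Xv vse]; exists v => //; apply: reaches_trans vse (reaches_edge e).
Qed.

Lemma in_split (T : Type) (x : T) t : List.In x t -> exists t1 t2, t = t1 ++ x :: t2.
Proof.
elim: t => //= y t IH [<-|/IH [t1 [t2 ->]]]; first by exists [::], t.
by exists (y :: t1), t2.
Qed.

Lemma path_through v w l : chain s r v l -> on_cycle s l w ->
  exists l1 l2, [/\ l = l1 ++ l2, chain s r w l2, pend r v l1 = w & l2 <> [::]].
Proof.
elim: l v => [|e l IH] v //= [<- cl] [<-|wl]; first by exists [::], (e :: l).
have [l1 [l2 [-> c2 p1 n2]]] := IH _ cl wl.
by exists (e :: l1), l2.
Qed.

(** Induction on the path: if the source of the new first edge recurs later, the loop is dropped by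
    restarting at that recurrence. *)
Lemma simple_path v l : chain s r v l -> exists l',
  [/\ chain s r v l', pend r v l' = pend r v l & List.NoDup (map s l')].
Proof.
elim: l v => [|e l IH] v /=; first by exists [::]; split => //; constructor.
move=> [<- /IH [l' [cl' pl' nl']]].
have [sel|sel] := pselect (on_cycle s l' (s e)); last first.
  by exists (e :: l'); split=> //=; constructor.
have [l1 [l2 [El c2 p1 n2]]] := path_through cl' sel.
exists l2; split=> //; first by rewrite -pl' El pend_cat p1.
by move: nl'; rewrite El map_cat; elim: l1 {El p1} => //= f l1 IH1 /List.NoDup_cons_iff [].
Qed.

(** Everything after the first edge is shortened to a simple path back to [v]. If that path does not
    pass through [v] as a source, the first edge closes it to a cycle; otherwise its part from [v]
    on is already a cycle. *)
Lemma closed_path_cycle v l : chain s r v l -> l <> [::] -> pend r v l = v ->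
  exists2 c, is_cycle s r c & on_cycle s c v.
Proof.
case: l => //= e l [<- cl] _ pl.
have [l' [cl' pl' nl']] := simple_path cl; rewrite pl in pl'.
have [sel|sel] := pselect (on_cycle s l' (s e)); last first.
  by exists (e :: l'); [split=> //=; split=> //; constructor | left].
have [l1 [l2 [El c2 p1 n2]]] := path_through cl' sel.
case: l2 n2 El c2 => // f l2 _ El c2.
exists (f :: l2); last by left; case: c2.
have sfe : s f = s e by case: c2.
have pf : pend r (s e) (f :: l2) = s e by rewrite -[X in pend r X _]p1 -pend_cat -El pl'.
split; first by rewrite sfe.
split; first by rewrite sfe pf.
by move: nl'; rewrite El map_cat; elim: l1 {El p1} => //= g l1 IH1 /List.NoDup_cons_iff [].
Qed.

Lemma cycle_rotate c v : is_cycle s r c -> on_cycle s c v ->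
  exists l1 l2, [/\ c = l1 ++ l2, chain s r v (l2 ++ l1),
     pend r v (l2 ++ l1) = v & l2 ++ l1 <> [::]].
Proof.
case: c => // e c [cc [pc _]] /(path_through cc) [l1 [l2 [El c2 p1 n2]]].
have p2 : pend r v l2 = s e by rewrite -p1 -pend_cat -El.
exists l1, l2; split=> //; last by case: l2 n2 {El c2 p2}.
- apply/chain_cat; split=> //; rewrite p2.
  by move: cc; rewrite El => /chain_cat [].
- by rewrite pend_cat p2.
Qed.

Lemma cycle_reaches c v w :
  is_cycle s r c -> on_cycle s c v -> on_cycle s c w -> reaches s r v w.
Proof.
move=> cc /(cycle_rotate cc) [l1 [l2 [Ec c21 _ _]]] wc.
have /(path_through c21) [m1 [m2 [Em _ pm _]]] : on_cycle s (l2 ++ l1) w.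
  move: wc; rewrite /on_cycle Ec !map_cat !List.in_app_iff; tauto.
by exists m1; split=> //; move: c21; rewrite Em => /chain_cat [].
Qed.

Lemma cycle_edge c e : is_cycle s r c -> List.In e c -> on_cycle s c (r e).
Proof.
case: c => // f c [cc [pc _]] /(@in_split _ _ _) [l1 [l2 El]].
have: chain s r (s f) (l1 ++ e :: l2) /\ pend r (s f) (l1 ++ e :: l2) = s f by rewrite -El.
rewrite chain_cat pend_cat /= => -[[_ [_ c2]]].
case: l2 El c2 => [|g l2] El /=; first by move=> _ ->; left.
by move=> [<- _] _; rewrite /on_cycle El map_cat List.in_app_iff /=; right; right; left.
Qed.

(** Without exits every edge starting on the cycle belongs to it, so the vertices of the cycle form
    a hereditary set. *)
Lemma no_exit_reaches c v w : is_cycle s r c -> ~ has_exit s c ->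
  on_cycle s c v -> reaches s r v w -> on_cycle s c w.
Proof.
move=> cc nex vc [l [cl <-]]; apply: (hereditary_reaches (H := on_cycle s c)) vc (reaches_pend cl).
move=> e ec; apply: cycle_edge => //; apply: contrapT => nec.
by apply: nex; exists e.
Qed.

(** The list witnessing finiteness may repeat edges or contain foreign ones; it is filtered and
    deduplicated with the classical equality of [{classic Ed}]. *)
Lemma not_infinite_emitter v : ~ infinite_emitter s v -> exists l, enumerates v l.
Proof.
move=> /contrapT [l Hl]; exists (filter (fun e : {classic Ed} => `[< s e = v >]) (undup (l : seq {classic Ed}))).
have In_mem (T : eqType) (x : T) t : List.In x t <-> x \in t.
  elim: t => //= y t IH; rewrite inE; split; first by move=> [->|/IH ->]; rewrite ?eqxx ?orbT.
  by case/orP => [/eqP ->|/IH]; [left|right].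
split.
  have: uniq (filter (fun e : {classic Ed} => `[< s e = v >]) (undup (l : seq {classic Ed}))).
    by rewrite filter_uniq // undup_uniq.
  elim: (filter _ _) => //= [_|x t IH /andP[/negP nx /IH ut]]; first by constructor.
  by constructor=> // /In_mem.
move=> e; rewrite (In_mem {classic Ed}) mem_filter mem_undup.
split=> [sev|/andP[/asboolP]//]; rewrite asboolT //=.
by apply/(In_mem {classic Ed}); apply: Hl.
Qed.

End Paths.

(** * All-reflexive graphs: covering the vertices by a hereditary saturated set *)

Section Cover.
Variables (V Ed : Type) (s r : Ed -> V).
Variables (H C : V -> Prop).
Hypothesis Er : all_reflexive s r.
Hypotheses (hH : hereditary s r H) (hC : hereditary s r C) (sC : saturated s r C).
Hypotheses (HC : forall v, H v -> C v)
           (nHC : forall v, ~ (exists2 h, H h & reaches s r v h) -> C v).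

Let near n v := exists l, [/\ chain s r v l, C (pend r v l) & size l = n].

Lemma off_reaches v : ~ C v -> exists2 h, H h & reaches s r v h.
Proof. by move=> nCv; apply: contrapT => /nHC. Qed.

(** The vertex [v] reaches some [h] in [H]. On a cycle without exits [h] lies on the cycle; on an
    extreme cycle [h] leads back to it. Either way [h] reaches [v], so [v] is in [H], hence in
    [C]. *)
Lemma off_not_cycle v c : ~ C v -> is_cycle s r c -> ~ on_cycle s c v.
Proof.
move=> nCv cc vc; have [h Hh vh] := off_reaches nCv.
have back : reaches s r h v -> False by move=> /(hereditary_reaches hH Hh)/HC.
case: (Er.1 c cc) => [nex|[_ ext]].
  exact/back/(cycle_reaches cc (no_exit_reaches cc nex vc vh) vc).
have [l [cl pl]] := vh; have [w [wc]] := ext _ _ vc cl; rewrite pl => hw.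
exact/back/(reaches_trans hw)/(cycle_reaches cc wc vc).
Qed.

(** Off [C] there are no cycles, hence no infinite emitters by clause (b), and no sinks, since [v]
    reaches [H] inside [C]. So [v] is regular and saturation applies. *)
Lemma off_edge v : ~ C v -> exists2 e, s e = v & ~ C (r e).
Proof.
move=> nCv; have nie : ~ infinite_emitter s v.
  by move=> /(Er.2.1 v) [c [cc]]; apply: off_not_cycle.
have [l El] := not_infinite_emitter nie.
apply: contrapT => nex; apply: (nCv); apply: sC.
  exists l => // l0; move: El; rewrite {}l0 => -[_ El].
  have [h Hh [[|e m] []]] := off_reaches nCv; first by move=> _ /= vh; apply: nCv; rewrite vh; apply: HC.
  by move=> [/El].
by move=> e sev; apply: contrapT => nCe; apply: nex; exists e.
Qed.

Definition leaves v := exists2 f, s f = v & C (r f).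

(** If no edge at [v] enters [C], the first edge of a shortest path into [C] is taken, so the
    distance to [C] drops. This makes vertices with [leaves] recur along the path built from these
    edges. *)
Lemma off_step v : ~ C v -> exists e, [/\ s e = v, ~ C (r e) &
  leaves v \/ forall n, near n.+1 v -> exists2 m, (m <= n)%N & near m (r e)].
Proof.
move=> nCv; have [lv|nlv] := pselect (leaves v).
  by have [e sev nCe] := off_edge nCv; exists e; split=> //; left.
have [h Hh [l [cl pl]]] := off_reaches nCv.
have exn : exists n, `[< near n v >].
  by exists (size l); apply/asboolP; exists l; split=> //; rewrite pl; apply: HC.
have [n /asboolP [m [cm Cm sm]] minn] := ex_minnP exn.
case: m cm Cm sm => [//|e m] /= [sev cm] Cm sm.
exists e; split=> //.
  by move=> Ce; apply: nlv; exists e.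
right=> k /asboolP /minn; rewrite -sm ltnS => le; exists (size m) => //.
by exists m.
Qed.

Lemma reflexive_cover v : C v.
Proof.
apply: contrapT => nCv0.
have [u|nxt nxtP] := @choice V Ed (fun v e => ~ C v -> [/\ s e = v, ~ C (r e) &
    leaves v \/ forall n, near n.+1 v -> exists2 m, (m <= n)%N & near m (r e)]).
  have [Cu|/off_step [e He]] := pselect (C u); last by exists e.
  (* On [C] the choice function needs only some default edge. *)
  by have [e _ _] := off_edge nCv0; exists e.
pose x n := iter n (fun v => r (nxt v)) v.
have nCx n : ~ C (x n) by elim: n => //= n /nxtP [].
pose a n := nxt (x n).
have sa n : s (a n) = x n by case: (nxtP _ (nCx n)).
have ra n : r (a n) = x n.+1 by [].
have pa : is_inf_path s r a by move=> n; rewrite sa.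
have xr n k : exists l, [/\ chain s r (x n) l, pend r (x n) l = x (n + k)%N & size l = k].
  elim: k n => [|k IH] n; first by exists [::]; rewrite addn0.
  have [l [cl pl sl]] := IH n.+1; exists (a n :: l).
  by rewrite /= ra sl pl sa addSnnS.
(* A repeated vertex would give a closed path, hence a cycle through a vertex off [C]. *)
have xinj i j : (i < j)%N -> x i <> x j.
  move=> ij xij; have [l [cl pl sl]] := xr i (j - i)%N.
  have [||c cc vc] := closed_path_cycle cl.
  - by move=> l0; move: sl; rewrite l0 /= => /esym/eqP; rewrite subn_eq0 leqNgt ij.
  - by rewrite pl subnKC // ltnW.
  by case: (off_not_cycle (nCx i) cc).
(* Induction on a bound for the distance from [x n] to [C]: each step of the path lowers it unless
   [x n] itself has an edge into [C]. *)
have exits n : exists2 m, (n <= m)%N & leaves (x m).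
  have [h Hh [l [cl pl]]] := off_reaches (nCx n).
  have: exists2 k, (k <= size l)%N & near k (x n).
    by exists (size l) => //; exists l; rewrite pl; split=> //; apply: HC.
  move: (size l) => k; elim: k n {h Hh l cl pl} => [|k IH] n [i].
    by rewrite leqn0 => /eqP -> [l [_ Cl /size0nil l0]]; case: (nCx n); move: Cl; rewrite l0.
  case: i => [_ [l [_ Cl /size0nil l0]]|i ik near_i]; first by case: (nCx n); move: Cl; rewrite l0.
  case: (nxtP _ (nCx n)) => _ _ [lv|/(_ _ near_i) [m mi nm]]; first by exists n.
  have [|m' nm' lm'] := IH n.+1; first by exists m => //; apply: leq_trans mi _.
  by exists m' => //; apply: ltnW.
have [L LP] := Er.2.2 a pa.
(* Clause (c) confines the edges leaving the path for good to the list [L]. As [x] is injective, it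
   eventually avoids all sources of edges in [L]. *)
have [N NP] : exists N, forall m, (N <= m)%N -> ~ List.In (x m) (map s L).
  elim: (map s L) => [|y t [N NP]]; first by exists 0%N => m _ [].
  have [[i xi]|ni] := pselect (exists i, x i = y); last first.
    by exists N => m Nm /= [ym|]; [apply: ni; exists m|apply: NP].
  exists (maxn N i.+1) => m; rewrite geq_max => /andP[Nm im] /= [ym|]; last exact: NP.
  by apply: (xinj _ _ im); rewrite xi.
have [m Nm [f sf Cf]] := exits N.
apply: (NP _ Nm); rewrite -sf; apply: List.in_map; apply: LP; split.
  by rewrite sf; exists m; left.
(* An edge into [C] cannot return to the path: [C] is hereditary and the path stays off it. *)
move=> [w [[i wi] fw]]; have: C w := hereditary_reaches hC Cf fw.
by case: wi => <-; [rewrite sa|rewrite ra]; apply: nCx.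
Qed.

End Cover.

(** * Subalgebras and endomorphism algebras *)

Local Notation "x ** y" := (nua_mul x y) (at level 40, left associativity).

Section AlgebraOnSubspace.
Variables (K : fieldType) (M : lmodType K).

(** Used for the linear maps inside [N -> N] and for the span of the monomials inside [A]. The laws
    [opnDr] and [opnZr] ask for a left factor in the carrier because composition is additive and
    homogeneous in the inner map only when the outer one is linear. *)
Record alg_on := AlgOn {
  carrier :> M -> Prop;
  opn : M -> M -> M;
  carrier0 : carrier 0;
  carrierD : forall x y, carrier x -> carrier y -> carrier (x + y);
  carrierZ : forall k x, carrier x -> carrier (k *: x);
  carrierM : forall x y, carrier x -> carrier y -> carrier (opn x y);
  opnA : forall x y z, opn x (opn y z) = opn (opn x y) z;
  opnDl : forall x y z, opn (x + y) z = opn x z + opn y z;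
  opnDr : forall x y z, carrier x -> opn x (y + z) = opn x y + opn x z;
  opnZl : forall k x y, opn (k *: x) y = k *: opn x y;
  opnZr : forall k x y, carrier x -> opn x (k *: y) = k *: opn x y }.

Variable a : alg_on.

Definition alg_pred : pred M := fun x => `[< a x >].

Lemma alg_pred_submod : submod_closed alg_pred.
Proof.
split; first exact/asboolP/carrier0.
by move=> k x y /asboolP ax /asboolP ay; apply/asboolP/carrierD => //; apply: carrierZ.
Qed.

HB.instance Definition _ := GRing.isSubmodClosed.Build K M alg_pred
  alg_pred_submod.

Definition alg_sort := {x : M | alg_pred x}.
HB.instance Definition _ := SubChoice.on alg_sort.
HB.instance Definition _ := [SubChoice_isSubLmodule of alg_sort by <:].

Lemma alg_sortP (x : alg_sort) : a (val x).
Proof. exact/asboolP/(valP x). Qed.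

Definition alg_in x (ax : a x) : alg_sort := Sub x (asboolT ax).

Definition alg_mul (x y : alg_sort) : alg_sort :=
  alg_in (carrierM (alg_sortP x) (alg_sortP y)).

Definition alg_of : nualg K.
Proof.
apply: (@NUAlg K alg_sort alg_mul).
- by move=> x y z; apply: val_inj; apply: opnA.
- by move=> x y z; apply: val_inj; apply: opnDl.
- by move=> x y z; apply: val_inj; apply: opnDr; apply: alg_sortP.
- by move=> k x y; apply: val_inj; apply: opnZl.
- by move=> k x y; apply: val_inj; apply: opnZr; apply: alg_sortP.
Defined.

End AlgebraOnSubspace.

Definition is_linear (K : fieldType) (N N' : lmodType K) (f : N -> N') : Prop :=
  (forall x y, f (x + y) = f x + f y) /\ (forall k x, f (k *: x) = k *: f x).

Section Endomorphisms.
Variables (K : fieldType) (N : lmodType K).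

Definition endo_on : alg_on (N -> N).
Proof.
apply: (@AlgOn K (N -> N) (@is_linear K N N) (fun f g x => f (g x))) => //.
- by split=> *; rewrite /= ?addr0 ?scaler0.
- move=> f g [fD fZ] [gD gZ]; split=> [x y|k x].
    by rewrite !fctE fD gD addrACA.
  by rewrite !fctE fZ gZ scalerDr.
- move=> k f [fD fZ]; split=> [x y|k' x].
    by rewrite !fctE fD scalerDr.
  by rewrite !fctE fZ !scalerA mulrC.
- by move=> f g [fD fZ] [gD gZ]; split=> [x y|k x]; rewrite ?gD ?gZ ?fD ?fZ.
- by move=> f g h [fD fZ]; apply/funext => x; rewrite !fctE fD.
- by move=> k f g [fD fZ]; apply/funext => x; rewrite !fctE fZ.
Defined.

Definition endo_alg : nualg K := alg_of endo_on.

Definition endo_in f (lf : is_linear f) : endo_alg := alg_in (a := endo_on) lf.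
Definition endo_fun (x : endo_alg) : N -> N := val x.

Lemma endo_inE f (lf : is_linear f) : endo_fun (endo_in lf) = f.
Proof. by []. Qed.

Lemma endo_funM (x y : endo_alg) z : endo_fun (x ** y) z = endo_fun x (endo_fun y z).
Proof. by []. Qed.

Lemma endo_funD (x y : endo_alg) z : endo_fun (x + y) z = endo_fun x z + endo_fun y z.
Proof. by []. Qed.

Lemma endo_funZ k (x : endo_alg) z : endo_fun (k *: x) z = k *: endo_fun x z.
Proof. by []. Qed.

Lemma endo_fun0 z : endo_fun 0 z = 0.
Proof. by []. Qed.

Lemma endo_fun_sum (I : Type) (t : seq I) (x : I -> endo_alg) z :
  endo_fun (\sum_(i <- t) x i) z = \sum_(i <- t) endo_fun (x i) z.
Proof. by elim: t => [|i t IH]; rewrite ?big_nil ?big_cons //= -IH. Qed.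

Lemma endo_funP (x y : endo_alg) : endo_fun x =1 endo_fun y -> x = y.
Proof. by move=> xy; apply/val_inj/funext. Qed.

End Endomorphisms.

(** * Linear spans and monomials *)

Inductive lspan (K : fieldType) (M : lmodType K) (G : M -> Prop) : M -> Prop :=
| span0 : lspan G 0
| spanL k x y : G x -> lspan G y -> lspan G (k *: x + y).

Section Span.
Variables (K : fieldType) (M : lmodType K).
Implicit Types (G : M -> Prop).

Lemma span_gen G x : G x -> lspan G x.
Proof. by move=> Gx; rewrite -[x]addr0 -[x]scale1r; apply: spanL => //; apply: span0. Qed.

Lemma span_add G x y : lspan G x -> lspan G y -> lspan G (x + y).
Proof.
move=> sx sy; elim: sx => [|k z t Gz _ IH]; first by rewrite add0r.
by rewrite -addrA; apply: spanL.
Qed.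

Lemma span_scale G k x : lspan G x -> lspan G (k *: x).
Proof.
elim=> [|k' y z Gy _ IH]; first by rewrite scaler0; apply: span0.
by rewrite scalerDr scalerA; apply: spanL.
Qed.

End Span.

Section SpanLinear.
Variables (K : fieldType) (M : lmodType K).
Implicit Types (G : M -> Prop).

Lemma is_linear_comp (M2 M3 : lmodType K) (g : M2 -> M3) (f : M -> M2) :
  is_linear f -> is_linear g -> is_linear (fun x => g (f x)).
Proof. by move=> [fD fZ] [gD gZ]; split=> *; rewrite ?fD ?fZ ?gD ?gZ. Qed.

Lemma linear0_of (M' : lmodType K) (f : M -> M') : is_linear f -> f 0 = 0.
Proof. by move=> [_ fZ]; rewrite -[0 in LHS](scale0r 0) fZ scale0r. Qed.

Lemma span_linear (M' : lmodType K) (G' : M' -> Prop) (f : M -> M') G : is_linear f ->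
  (forall x, G x -> lspan G' (f x)) -> forall x, lspan G x -> lspan G' (f x).
Proof.
move=> lf fG x; elim=> [|k y z Gy _ IH]; first by rewrite linear0_of //; apply: span0.
by have [fD fZ] := lf; rewrite fD fZ; apply: span_add => //; apply/span_scale/fG.
Qed.

Lemma span_sub G G' : (forall x, G x -> G' x) -> forall x, lspan G x -> lspan G' x.
Proof. by move=> GG' x; apply: (span_linear (f := id)) => // y /GG'; apply: span_gen. Qed.

Lemma span_linear0 (M' : lmodType K) (f : M -> M') G : is_linear f ->
  (forall x, G x -> f x = 0) -> forall x, lspan G x -> f x = 0.
Proof.
move=> lf fG x; elim=> [|k y z Gy _ IH]; first exact: linear0_of.
by have [fD fZ] := lf; rewrite fD fZ fG // IH scaler0 addr0.
Qed.

Lemma linear_eq_span (M' : lmodType K) (f g : M -> M') G : is_linear f -> is_linear g ->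
  (forall x, G x -> f x = g x) -> forall x, lspan G x -> f x = g x.
Proof.
move=> lf lg fg x; elim=> [|k y z Gy _ IH]; first by rewrite !linear0_of.
by have [fD fZ] := lf; have [gD gZ] := lg; rewrite fD fZ gD gZ fg // IH.
Qed.

(* [E] behaves like a family of orthogonal projections resolving the identity
   on the lspan, each generator lying in the image of exactly one of them. *)
Lemma span_resolution (T : eqType) (E : T -> M -> M) G :
  (forall t, is_linear (E t)) ->
  (forall x, G x -> exists t0, E t0 x = x /\ forall t, t <> t0 -> E t x = 0) ->
  forall x, lspan G x -> exists F : seq T, uniq F /\
    forall F', uniq F' -> {subset F <= F'} -> x = \sum_(t <- F') E t x.
Proof.
move=> lE EG x; elim=> [|k y z Gy _ [F [_ FP]]].
  by exists [::]; split=> // F' _ _; rewrite big1 // => t _; rewrite linear0_of.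
have [t0 [Et0 Et]] := EG y Gy.
exists (undup (t0 :: F)); split; first exact: undup_uniq.
move=> F' uF' sF'.
have t0F' : t0 \in F' by apply: sF'; rewrite mem_undup mem_head.
have sF : {subset F <= F'}.
  by move=> t tF; apply: sF'; rewrite mem_undup inE tF orbT.
rewrite [in LHS](FP _ uF' sF).
under [RHS]eq_bigr => t _ do rewrite (lE t).1 (lE t).2.
rewrite big_split /=; congr (_ + _).
rewrite (bigD1_seq t0) //= Et0 big1 ?addr0 // => t /eqP tt0.
by rewrite Et // scaler0.
Qed.

Lemma span_resolution_neq0 (T : eqType) (E : T -> M -> M) G :
  (forall t, is_linear (E t)) ->
  (forall x, G x -> exists t0, E t0 x = x /\ forall t, t <> t0 -> E t x = 0) ->
  forall x, lspan G x -> x <> 0 -> exists t, E t x <> 0.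
Proof.
move=> lE EG x sx xn0; have [F [uF FP]] := span_resolution lE EG sx.
apply: contrapT => nE; apply: xn0; rewrite (FP F) // big1 // => t _.
by apply: contrapT => Et; apply: nE; exists t.
Qed.

End SpanLinear.

Section Nualg.
Variables (K : fieldType) (A : nualg K).
Implicit Types x y z : A.

Lemma nua_linear_l x : is_linear (fun y => y ** x).
Proof. by split=> *; rewrite ?nua_mulDl ?nua_mulZl. Qed.

Lemma nua_linear_r x : is_linear (fun y => x ** y).
Proof. by split=> *; rewrite ?nua_mulDr ?nua_mulZr. Qed.

Lemma nua_mul0 x : x ** 0 = 0.
Proof. exact: linear0_of (nua_linear_r x). Qed.

Lemma nua_0mul x : 0 ** x = 0.
Proof. exact: linear0_of (nua_linear_l x). Qed.

Lemma nua_mul_sumr (I : Type) (t : seq I) (f : I -> A) x :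
  x ** (\sum_(i <- t) f i) = \sum_(i <- t) x ** f i.
Proof. by elim: t => [|i t IH]; rewrite ?big_nil ?big_cons ?nua_mul0 ?nua_mulDr ?IH. Qed.

Lemma nua_mul_suml (I : Type) (t : seq I) (f : I -> A) x :
  (\sum_(i <- t) f i) ** x = \sum_(i <- t) f i ** x.
Proof. by elim: t => [|i t IH]; rewrite ?big_nil ?big_cons ?nua_0mul ?nua_mulDl ?IH. Qed.

End Nualg.

(** * Monomials of a Leavitt family and the ideals of hereditary sets *)

Section Family.
Variables (K : fieldType) (V Ed : Type) (s r : Ed -> V).
Variables (A : nualg K) (P : V -> A) (S St : Ed -> A).
Hypothesis LF : leavitt_family s r A P S St.
Implicit Types (u v w : V) (e f : Ed) (l m k : seq Ed).

Lemma PP v : P v ** P v = P v. Proof. by case: LF. Qed.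
Lemma PP0 v w : v <> w -> P v ** P w = 0. Proof. by case: LF => _ [H _]; apply: H. Qed.
Lemma PS e : P (s e) ** S e = S e. Proof. by case: LF => _ [_ [H _]]; case: (H e). Qed.
Lemma SP e : S e ** P (r e) = S e. Proof. by case: LF => _ [_ [H _]]; case: (H e). Qed.
Lemma PSt e : P (r e) ** St e = St e. Proof. by case: LF => _ [_ [_ [H _]]]; case: (H e). Qed.
Lemma StP e : St e ** P (s e) = St e. Proof. by case: LF => _ [_ [_ [H _]]]; case: (H e). Qed.
Lemma StS e : St e ** S e = P (r e). Proof. by case: LF => _ [_ [_ [_ [H _]]]]. Qed.
Lemma StS0 e f : e <> f -> St e ** S f = 0.
Proof. by case: LF => _ [_ [_ [_ [_ [H _]]]]]; apply: H. Qed.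
Lemma CK2 v l : enumerates s v l -> l <> [::] -> P v = \sum_(e <- l) S e ** St e.
Proof. by case: LF => _ [_ [_ [_ [_ [_ H]]]]] [nl El]; apply: H. Qed.

Local Notation sp := (spath P S).
Local Notation sg := (sghost P St).
Local Notation chain := (chain s r).
Local Notation pend := (pend r).

Lemma spath_cons v e l : sp v (e :: l) = S e ** sp (r e) l.
Proof. by case: l => //=; rewrite SP. Qed.

Lemma sghost_cons v e l : sg v (e :: l) = sg (r e) l ** St e.
Proof. by case: l => //=; rewrite PSt. Qed.

Lemma PS_neq v e : v <> s e -> P v ** S e = 0.
Proof. by move=> ve; rewrite -PS nua_mulA PP0 // nua_0mul. Qed.

Lemma StP_neq v e : v <> s e -> St e ** P v = 0.
Proof. by move=> ve; rewrite -StP -nua_mulA PP0 ?nua_mul0 //; apply/nesym. Qed.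

Lemma P_spath v l : chain v l -> P v ** sp v l = sp v l.
Proof. by case: l => [|e l]; [rewrite /= PP | move=> [<- _]; rewrite spath_cons nua_mulA PS]. Qed.

Lemma P_spath_neq v w l : chain w l -> v <> w -> P v ** sp w l = 0.
Proof. by move=> cl vw; rewrite -P_spath // nua_mulA PP0 // nua_0mul. Qed.

Lemma sghost_P v l : chain v l -> sg v l ** P v = sg v l.
Proof. by case: l => [|e l]; [rewrite /= PP | move=> [<- _]; rewrite sghost_cons -nua_mulA StP]. Qed.

Lemma sghost_P_neq v w l : chain w l -> v <> w -> sg w l ** P v = 0.
Proof. by move=> cl vw; rewrite -sghost_P // -nua_mulA PP0 ?nua_mul0 //; apply/nesym. Qed.

Lemma spath_cat v l m : chain v (l ++ m) -> sp v (l ++ m) = sp v l ** sp (pend v l) m.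
Proof.
elim: l v => [|e l IH] v; first by move=> cm; rewrite /= P_spath.
by move=> [_ cl]; rewrite cat_cons !spath_cons IH // nua_mulA.
Qed.

Lemma sghost_cat v l m : chain v (l ++ m) -> sg v (l ++ m) = sg (pend v l) m ** sg v l.
Proof.
elim: l v => [|e l IH] v; first by move=> cm; rewrite /= sghost_P.
by move=> [_ cl]; rewrite cat_cons !sghost_cons IH // nua_mulA.
Qed.

Lemma sghost_spath v l : chain v l -> sg v l ** sp v l = P (pend v l).
Proof.
elim: l v => [|e l IH] v; first by rewrite /= PP.
move=> [_ cl]; rewrite spath_cons sghost_cons -nua_mulA [St e ** _]nua_mulA StS.
by rewrite P_spath // IH.
Qed.

Lemma sghost_spath_neq v w l m : chain v l -> chain w m -> v <> w -> sg v l ** sp w m = 0.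
Proof.
by move=> cl cm vw; rewrite -P_spath // nua_mulA sghost_P_neq ?nua_0mul //; apply/nesym.
Qed.

(** Equal first edges cancel to a vertex and distinct ones give 0, so a nonzero product lets the
    comparison run until one path is exhausted. *)
Lemma sghost_spath_comparable v l m : chain v l -> chain v m -> sg v l ** sp v m <> 0 ->
  (exists k, m = l ++ k) \/ (exists k, l = m ++ k).
Proof.
elim: l v m => [|e l IH] v m; first by left; exists m.
case: m => [|f m]; first by right; exists (e :: l).
move=> [sev cl] [sfv cm]; rewrite spath_cons sghost_cons -nua_mulA [St e ** _]nua_mulA.
have [ef|ef] := pselect (e = f); last by rewrite StS0 // nua_0mul nua_mul0.
subst f; rewrite StS P_spath // => /(IH _ _ cl cm) [[k ->]|[k ->]]; [left|right]; by exists k.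
Qed.

(* [Q a b v] constrains the lengths [a], [b] of the two paths of the monomial
   and their common endpoint [v]. *)
Definition monomial (Q : nat -> nat -> V -> Prop) (x : A) : Prop :=
  exists v w l m, [/\ chain v l, chain w m, pend v l = pend w m,
    Q (size l) (size m) (pend v l) & x = sp v l ** sg w m].

(** For hereditary [H] these monomials span the ideal generated by the vertices in [H]. *)
Definition ending_in (H : V -> Prop) : nat -> nat -> V -> Prop := fun _ _ v => H v.

Section Ideals.
Variable H : V -> Prop.
Hypothesis hH : hereditary s r H.
Local Notation IH := (lspan (monomial (ending_in H))).

Lemma monomial_P_l v x : monomial (ending_in H) x -> IH (P v ** x).
Proof.
move=> [u [w [l [m [cl cm plm Hl ->]]]]]; rewrite nua_mulA.
have [->|vu] := pselect (v = u); last by rewrite P_spath_neq // nua_0mul; apply: span0.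
by rewrite P_spath //; apply: span_gen; exists u, w, l, m.
Qed.

Lemma monomial_P_r v x : monomial (ending_in H) x -> IH (x ** P v).
Proof.
move=> [u [w [l [m [cl cm plm Hl ->]]]]]; rewrite -nua_mulA.
have [->|vu] := pselect (v = w); last by rewrite sghost_P_neq // nua_mul0; apply: span0.
by rewrite sghost_P //; apply: span_gen; exists u, w, l, m.
Qed.

Lemma monomial_S_l e x : monomial (ending_in H) x -> IH (S e ** x).
Proof.
move=> [u [w [l [m [cl cm plm Hl ->]]]]]; rewrite nua_mulA.
have [ru|ru] := pselect (r e = u); last first.
  by rewrite -SP -(nua_mulA (S e)) P_spath_neq // nua_mul0 nua_0mul; apply: span0.
apply: span_gen; exists (s e), w, (e :: l), m; rewrite spath_cons /= ru; split=> //.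
Qed.

Lemma monomial_St_r e x : monomial (ending_in H) x -> IH (x ** St e).
Proof.
move=> [u [w [l [m [cl cm plm Hl ->]]]]]; rewrite -nua_mulA.
have [ru|ru] := pselect (r e = w); last first.
  by rewrite -PSt [sg _ _ ** _]nua_mulA sghost_P_neq // nua_0mul nua_mul0; apply: span0.
by apply: span_gen; exists u, (s e), l, (e :: m); rewrite sghost_cons /= ru.
Qed.

(** A nonempty real path loses its first edge. When it is empty, [St e] joins the ghost path instead
    and the common endpoint moves on to [r e]; this is where [hH] enters. *)
Lemma monomial_St_l e x : monomial (ending_in H) x -> IH (St e ** x).
Proof.
move=> [u [w [[|f l] [m [cl cm plm Hl ->]]]]]; rewrite nua_mulA.
  rewrite /= in plm Hl *; have [us|us] := pselect (u = s e); last first.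
    by rewrite StP_neq // nua_0mul; apply: span0.
  have cme : chain w (m ++ [:: e]) by apply/chain_cat; split=> //=; rewrite -plm us.
  apply: span_gen; exists (r e), w, [::], (m ++ [:: e]); split=> //=.
  - by rewrite pend_cat.
  - by apply: hH; rewrite -us.
  - by rewrite us StP sghost_cat //= nua_mulA PSt.
have [ef|ef] := pselect (e = f); last first.
  by rewrite spath_cons nua_mulA StS0 // !nua_0mul; apply: span0.
subst f; case: cl => _ cl; rewrite spath_cons nua_mulA StS P_spath //.
by apply: span_gen; exists (r e), w, l, m.
Qed.

Lemma monomial_S_r e x : monomial (ending_in H) x -> IH (x ** S e).
Proof.
move=> [u [w [l [[|f m] [cl cm plm Hl ->]]]]]; rewrite -nua_mulA.
  rewrite /= in plm *; have [ws|ws] := pselect (w = s e); last first.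
    by rewrite PS_neq // nua_mul0; apply: span0.
  have cle : chain u (l ++ [:: e]) by apply/chain_cat; split=> //=; rewrite plm ws.
  apply: span_gen; exists u, (r e), (l ++ [:: e]), [::]; split=> //=.
  - by rewrite pend_cat.
  - by rewrite pend_cat; apply: hH; rewrite -ws -plm.
  - by rewrite ws PS spath_cat //= -nua_mulA SP.
have [ef|ef] := pselect (f = e); last first.
  by rewrite sghost_cons -nua_mulA StS0 // !nua_mul0; apply: span0.
subst f; case: cm => _ cm; rewrite sghost_cons -nua_mulA StS sghost_P //.
by apply: span_gen; exists u, (r e), l, m.
Qed.

(** The factor [y] is applied one edge at a time, first its ghost path and then its real path. *)
Lemma ideal_monomial_l y x : monomial (fun _ _ _ => True) y -> IH x -> IH (y ** x).
Proof.
move=> [u [w [l [m [cl cm plm _ ->]]]]] Ix; rewrite -nua_mulA.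
have Im : IH (sg w m ** x).
  elim: m w {cm plm} x Ix => [|e m IHm] w x Ix /=.
    by apply: (span_linear (nua_linear_r _)) Ix => z; apply: monomial_P_l.
  rewrite -/(sg w (e :: m)) sghost_cons -nua_mulA; apply: IHm.
  by apply: (span_linear (nua_linear_r _)) Ix => z; apply: monomial_St_l.
elim: l u {cl plm} => [|e l IHl] u /=.
  by apply: (span_linear (nua_linear_r _)) Im => z; apply: monomial_P_l.
rewrite -/(sp u (e :: l)) spath_cons -nua_mulA.
by apply: (span_linear (nua_linear_r _)) (IHl (r e)) => z; apply: monomial_S_l.
Qed.

Lemma ideal_monomial_r y x : monomial (fun _ _ _ => True) y -> IH x -> IH (x ** y).
Proof.
move=> [u [w [l [m [cl cm plm _ ->]]]]] Ix; rewrite nua_mulA.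
have Il : IH (x ** sp u l).
  elim: l u {cl plm} x Ix => [|e l IHl] u x Ix /=.
    by apply: (span_linear (nua_linear_l _)) Ix => z; apply: monomial_P_r.
  rewrite -/(sp u (e :: l)) spath_cons nua_mulA; apply: IHl.
  by apply: (span_linear (nua_linear_l _)) Ix => z; apply: monomial_S_r.
elim: m w {cm plm} => [|e m IHm] w /=.
  by apply: (span_linear (nua_linear_l _)) Il => z; apply: monomial_P_r.
rewrite -/(sg w (e :: m)) sghost_cons nua_mulA.
by apply: (span_linear (nua_linear_l _)) (IHm (r e)) => z; apply: monomial_St_r.
Qed.

End Ideals.
End Family.

(** * Vertices are nonzero; the grading *)

Local Notation full := (fun _ => True).
Local Notation all_monomials := (ending_in full).
Local Notation degree n := (fun a b _ => a%:Z - b%:Z = n).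

Section Boundary.
Variables (K : fieldType) (V Ed : Type) (s r : Ed -> V).

(* A boundary path is an infinite path, or a path to a non-regular vertex [v]
   padded with the constant sequence [inr v]. *)
Definition src (x : Ed + V) : V := match x with inl e => s e | inr v => v end.
Definition tgt (x : Ed + V) : V := match x with inl e => r e | inr v => v end.
Definition boundary (p : nat -> Ed + V) : Prop := forall n,
  src (p n.+1) = tgt (p n) /\ forall v, p n = inr v -> p n.+1 = inr v /\ ~ regular s v.

Definition bcons (e : Ed) (p : nat -> Ed + V) n := if n is n'.+1 then p n' else inl e.
Definition btail (p : nat -> Ed + V) n := p n.+1.

Lemma bconsK e p : btail (bcons e p) = p. Proof. exact/funext. Qed.
Lemma btailK e p : p 0%N = inl e -> bcons e (btail p) = p.
Proof. by move=> pe; apply/funext => -[]. Qed.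

Lemma boundary_cons e p : boundary p -> src (p 0%N) = r e -> boundary (bcons e p).
Proof. by move=> bp pe [|n] /=; [split | apply: bp]. Qed.
Lemma boundary_tail p : boundary p -> boundary (btail p).
Proof. by move=> bp n; apply: bp. Qed.

Local Notation X := (nat -> Ed + V).
Local Notation N := (X -> K^o).
(** On delta functions this is the usual action on boundary paths: [bS e] prepends [e] and [bSt e]
    removes it. Using arbitrary functions avoids any condition of finite support. *)
Definition bP v (f : N) : N := fun p => if `[< boundary p /\ src (p 0%N) = v >] then f p else 0.
Definition bS e (f : N) : N := fun p => if `[< boundary p /\ p 0%N = inl e >] then f (btail p) else 0.
Definition bSt e (f : N) : N := fun p => if `[< boundary p /\ src (p 0%N) = r e >] then f (bcons e p) else 0.

Lemma bP_linear v : is_linear (bP v).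
Proof. by split=> *; apply/funext => p; rewrite /bP !fctE; case: ifP; rewrite ?addr0 ?scaler0. Qed.
Lemma bS_linear e : is_linear (bS e).
Proof. by split=> *; apply/funext => p; rewrite /bS !fctE; case: ifP; rewrite ?addr0 ?scaler0. Qed.
Lemma bSt_linear e : is_linear (bSt e).
Proof. by split=> *; apply/funext => p; rewrite /bSt !fctE; case: ifP; rewrite ?addr0 ?scaler0. Qed.

Lemma boundary_family : leavitt_family s r (endo_alg N)
  (fun v => endo_in (bP_linear v)) (fun e => endo_in (bS_linear e)) (fun e => endo_in (bSt_linear e)).
Proof.
split=> [v|]; first by apply: endo_funP => f; apply/funext => p; rewrite endo_funM !endo_inE /bP; case: asboolP.
split=> [v w vw|].
  apply: endo_funP => f; apply/funext => p; rewrite endo_funM !endo_inE endo_fun0 /bP.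
  by case: asboolP => // -[_ pv]; case: asboolP => // -[_ pw]; case: vw; rewrite -pv.
have tl p e : boundary p -> p 0%N = inl e -> src (btail p 0%N) = r e.
  by move=> bp pe; rewrite /btail (bp 0%N).1 pe.
split=> [e|].
  split; apply: endo_funP => f; apply/funext => p; rewrite endo_funM !endo_inE /bP /bS.
    by case: (asboolP (_ /\ src _ = _)) => // nb; case: asboolP => // -[bp pe]; case: nb; rewrite pe.
  case: asboolP => // -[bp pe]; rewrite asboolT //; split; [exact: boundary_tail|exact: tl].
split=> [e|].
  split; apply: endo_funP => f; apply/funext => p; rewrite endo_funM !endo_inE /bP /bSt.
    by case: asboolP.
  case: asboolP => // -[bp pe]; rewrite asboolT //; split=> //; exact: boundary_cons.
split=> [e|].
  apply: endo_funP => f; apply/funext => p; rewrite endo_funM !endo_inE /bP /bSt /bS.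
  by case: asboolP => // -[bp pe]; rewrite asboolT ?bconsK //; split=> //; exact: boundary_cons.
split=> [e f ef|v l nl El l0].
  apply: endo_funP => g; apply/funext => p; rewrite endo_funM !endo_inE endo_fun0 /bSt /bS.
  by case: asboolP => // -[bp pe]; case: asboolP => // -[_ /= [] /ef].
apply: endo_funP => f; apply/funext => p; rewrite endo_inE endo_fun_sum /bP.
have -> : (\sum_(e <- l) endo_fun (endo_in (bS_linear e) ** endo_in (bSt_linear e)) f) p
    = \sum_(e <- l) if `[< boundary p /\ p 0%N = inl e >] then f p else 0.
  elim: l {nl El l0} => [|e l IH]; first by rewrite !big_nil.
  rewrite !big_cons -IH fctE; congr (_ + _).
  rewrite endo_funM !endo_inE /bS /bSt.
  case: asboolP => // -[bp pe]; rewrite asboolT ?btailK //; split; [exact: boundary_tail|exact: tl].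
have rv : regular s v by exists l.
(* At a regular vertex [p] cannot be padding, so it begins with exactly one edge of [l] and exactly
   one summand survives. *)
case: asboolP => [[bp pv]|nb].
  case: (p 0%N) (bp 0%N).2 pv => [e _ /= sev|w Hw /= wv]; last first.
    by subst w; case: (Hw _ erefl).
  have lin : List.In e l by apply/El.
  have [l1 [l2 El2]] := in_split lin; move: nl; rewrite El2 => nl.
  have [n1 n2] : ~ List.In e l1 /\ ~ List.In e l2.
    by have := List.NoDup_remove_2 _ _ _ nl; rewrite List.in_app_iff; tauto.
  have z m : ~ List.In e m ->
      \sum_(i <- m) (if `[< boundary p /\ inl e = inl i :> Ed + V >] then f p else 0) = 0.
    elim: m => [|i m IH] nm; first by rewrite big_nil.
    rewrite big_cons IH ?asboolF ?addr0 //; first by case=> _ [ei]; apply: nm; left.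
    by move=> em; apply: nm; right.
  by rewrite big_cat big_cons /= !z // asboolT // add0r addr0.
suff: forall m, (forall e, List.In e m -> s e = v) ->
    \sum_(e <- m) (if `[< boundary p /\ p 0%N = inl e >] then f p else 0) = 0.
  by move=> -> // e /El.
elim=> [|e m IH] Hm; first by rewrite big_nil.
rewrite big_cons IH; last by move=> i im; apply: Hm; right.
rewrite asboolF ?addr0 // => -[bp pe]; apply: nb; split=> //; rewrite pe /=; apply: Hm; by left.
Qed.

(** An edge is followed from every regular vertex, and the first non-regular vertex met is repeated
    forever. *)
Lemma boundary_exists v : exists2 p, boundary p & src (p 0%N) = v.
Proof.
have [u|nxt nxtP] := @choice V (Ed + V)%type
    (fun u x => src x = u /\ forall w, x = inr w -> w = u /\ ~ regular s u).
  have [[[|e l] [_ El] //]|nr] := pselect (regular s u).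
    by move=> _; exists (inl e); split=> //=; apply/El; left.
  by exists (inr u); split=> // w [].
pose p n := iter n (fun x => nxt (tgt x)) (nxt v).
exists p; last by case: (nxtP v).
have pn n : exists u, p n = nxt u by case: n => [|n]; [exists v | exists (tgt (p n))].
move=> n; split; first by case: (nxtP (tgt (p n))).
move=> w pw; have [u pu] := pn n.
have [wu nru] := (nxtP u).2 w (eq_trans (esym pu) pw).
have -> : p n.+1 = nxt (tgt (p n)) by [].
by rewrite pw /= wu -pu pw wu.
Qed.

(** In the representation on boundary paths, [P v] sends the constant function 1 to a function with
    value 1 at a boundary path starting at [v]. *)
Lemma vertex_neq0 (A : nualg K) (P : V -> A) (S St : Ed -> A) v :
  is_leavitt_path_algebra s r A P S St -> P v <> 0.
Proof.
move=> [_ univ] Pv0; have [[f [[fD [fZ fM]] [fP _]]] _] := univ _ _ _ _ boundary_family.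
have [p bp pv] := boundary_exists v.
have := fP v; rewrite Pv0 (_ : f 0 = 0); last by rewrite -(scale0r 0) fZ scale0r.
move=> /(congr1 (fun x => endo_fun x (fun=> 1) p)); rewrite endo_fun0 endo_inE /bP asboolT //.
by move=> /eqP; rewrite eq_sym oner_eq0.
Qed.
End Boundary.

Section Universal.
Variables (K : fieldType) (V Ed : Type) (s r : Ed -> V).
Variables (A : nualg K) (P : V -> A) (S St : Ed -> A).
Hypothesis LPA : is_leavitt_path_algebra s r A P S St.
Let LF : leavitt_family s r A P S St := LPA.1.
Local Notation monomial := (monomial s r P S St).

Definition span_alg : alg_on A.
Proof.
refine (@AlgOn K A (lspan (monomial all_monomials)) (@nua_mul K A) _ _ _ _ _ _ _ _ _).
- exact: span0.
- exact: span_add.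
- exact: span_scale.
- move=> x y sx sy; apply: (span_linear (nua_linear_l y)) sx => z mz.
  exact: (ideal_monomial_l LF).
- exact: nua_mulA.
- exact: nua_mulDl.
- by move=> *; apply: nua_mulDr.
- exact: nua_mulZl.
- by move=> *; apply: nua_mulZr.
Defined.

Lemma span_P v : lspan (monomial all_monomials) (P v).
Proof. by apply: span_gen; exists v, v, [::], [::]; split=> //=; rewrite (PP LF). Qed.

Lemma span_S e : lspan (monomial all_monomials) (S e).
Proof. by apply: span_gen; exists (s e), (r e), [:: e], [::]; split=> //=; rewrite (SP LF). Qed.

Lemma span_St e : lspan (monomial all_monomials) (St e).
Proof. by apply: span_gen; exists (r e), (s e), [::], [:: e]; split=> //=; rewrite (PSt LF). Qed.

(** The span of the monomials is a subalgebra containing a Leavitt family. The universal map into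
    it, followed by the inclusion, fixes the generators and so is the identity by uniqueness. *)
Lemma spanning x : lspan (monomial all_monomials) x.
Proof.
pose P' v : alg_of span_alg := alg_in (a := span_alg) (span_P v).
pose S' e : alg_of span_alg := alg_in (a := span_alg) (span_S e).
pose St' e : alg_of span_alg := alg_in (a := span_alg) (span_St e).
have F' : leavitt_family s r (alg_of span_alg) P' S' St'.
  split=> [v|]; first exact/val_inj/(PP LF).
  split=> [v w vw|]; first exact/val_inj/(PP0 LF).
  split=> [e|]; first by split; apply: val_inj; [apply: (PS LF)|apply: (SP LF)].
  split=> [e|]; first by split; apply: val_inj; [apply: (PSt LF)|apply: (StP LF)].
  split=> [e|]; first exact/val_inj/(StS LF).
  split=> [e f ef|v l nl El l0]; first exact/val_inj/(StS0 LF).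
  apply: val_inj; rewrite /= (CK2 LF (conj nl El) l0).
  elim: l {nl El l0} => [|e l IH]; first by rewrite !big_nil.
  by rewrite !big_cons IH.
have [[f [[fD [fZ fM]] [fP [fS fSt]]]] _] := LPA.2 _ _ _ _ F'.
have [_ uniq_hom] := LPA.2 _ _ _ _ LF.
have -> : x = val (f x).
  apply: (uniq_hom id (fun y => val (f y))) => //.
  - split=> [y z|]; first by rewrite fD.
    by split=> [k y|y z]; rewrite ?fZ ?fM.
  - by move=> v; rewrite fP.
  - by move=> e; rewrite fS.
  - by move=> e; rewrite fSt.
exact: (@alg_sortP _ _ span_alg (f x)).
Qed.

(* [shift_op x d] is left multiplication by the Laurent monomial [x t^d] on the
   two-sided formal series in [t] over the unitization [K * A] of [A]. *)
Local Notation N := (int -> K^o * A)%type.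
Definition shift_op (x : A) (d : int) (f : N) : N :=
  fun n => (0, (f (n - d)).1 *: x + x ** (f (n - d)).2).

Lemma shift_op_linear x d : is_linear (shift_op x d).
Proof.
split=> *; apply/funext => n; rewrite /shift_op !fctE; congr (_, _) => /=.
- by rewrite addr0.
- by rewrite scalerDl nua_mulDr addrACA.
- by rewrite scaler0.
- by rewrite nua_mulZr scalerDr scalerA.
Qed.

Definition shift x d : endo_alg N := endo_in (shift_op_linear x d).

Lemma shiftM x y c d : shift x c ** shift y d = shift (x ** y) (c + d).
Proof.
apply: endo_funP => f; apply/funext => n; rewrite endo_funM !endo_inE /shift_op /=.
by congr (_, _); rewrite scale0r add0r nua_mulDr nua_mulZr nua_mulA opprD addrA.
Qed.

Lemma shift0 d : shift 0 d = 0.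
Proof.
apply: endo_funP => f; apply/funext => n; rewrite endo_inE endo_fun0 /shift_op.
by rewrite scaler0 nua_0mul addr0.
Qed.

Lemma shiftD x y d : shift (x + y) d = shift x d + shift y d.
Proof.
apply: endo_funP => f; apply/funext => n; rewrite endo_funD !endo_inE /shift_op.
by congr (_, _); rewrite /= ?addr0 // scalerDr nua_mulDl addrACA.
Qed.

Lemma shift_family : leavitt_family s r (endo_alg N)
  (fun v => shift (P v) 0) (fun e => shift (S e) 1) (fun e => shift (St e) (-1)).
Proof.
split=> [v|]; first by rewrite shiftM (PP LF).
split=> [v w vw|]; first by rewrite shiftM (PP0 LF) // shift0.
split=> [e|]; first by rewrite !shiftM (PS LF) (SP LF).
split=> [e|]; first by rewrite !shiftM (PSt LF) (StP LF).
split=> [e|]; first by rewrite !shiftM (StS LF).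
split=> [e f ef|v l nl El l0]; first by rewrite shiftM (StS0 LF) // shift0.
rewrite (CK2 LF (conj nl El) l0).
elim: l {nl El l0} => [|e l IH]; first by rewrite !big_nil shift0.
by rewrite !big_cons shiftD IH shiftM.
Qed.

Lemma grading : exists component : int -> A -> A, (forall n, is_linear (component n)) /\
  forall n d x, lspan (monomial (degree d)) x -> component n x = if n == d then x else 0.
Proof.
have [[f [[fD [fZ fM]] [fP [fS fSt]]]] _] := LPA.2 _ _ _ _ shift_family.
(* The unit of the unitization placed in degree 0: [shift x d] sends it to [x] in degree [d], so
   coefficient [n] of the image is the component of degree [n]. *)
pose f0 : N := fun n => (if n == 0 then 1 else 0, 0).
have lin n : is_linear (fun x => (endo_fun (f x) f0 n).2).
  by split=> [x y|k x]; [rewrite fD endo_funD | rewrite fZ endo_funZ].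
exists (fun n x => (endo_fun (f x) f0 n).2); split=> // n d.
have fsp v l : f (spath P S v l) = shift (spath P S v l) (size l).
  elim: l v => [|e l IH] v; first exact: fP.
  by rewrite !(spath_cons LF) fM fS IH shiftM.
have fsg v l : f (sghost P St v l) = shift (sghost P St v l) (- (size l)%:Z).
  elim: l v => [|e l IH] v; first by rewrite oppr0; apply: fP.
  by rewrite !(sghost_cons LF) fM fSt IH shiftM -opprD -PoszD addn1.
move=> x; apply: (linear_eq_span (lin n) (g := fun x => if n == d then x else 0)).
  by split=> *; case: ifP; rewrite ?addr0 ?scaler0.
move=> _ [v [w [l [m [cl cm plm Hd ->]]]]]; rewrite fM fsp fsg shiftM endo_inE /shift_op /f0 /=.
rewrite Hd nua_mul0 addr0 subr_eq0; by case: ifP; rewrite ?scale1r ?scale0r.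
Qed.

End Universal.

(** * Graded ideals *)

Lemma linear_sum (K : fieldType) (M N : lmodType K) (f : M -> N) (I : Type) (t : seq I) g :
  is_linear f -> f (\sum_(i <- t) g i) = \sum_(i <- t) f (g i).
Proof.
move=> lf; elim: t => [|i t IH]; first by rewrite !big_nil linear0_of.
by rewrite !big_cons lf.1 IH.
Qed.

Section Ideal.
Variables (K : fieldType) (A : nualg K) (I : A -> Prop).
Hypothesis iI : is_ideal I.

Lemma is_ideal0 : I 0. Proof. by case: iI. Qed.
Lemma is_idealD x y : I x -> I y -> I (x + y). Proof. by case: iI => _ [H _]; apply: H. Qed.
Lemma is_idealZ k x : I x -> I (k *: x). Proof. by case: iI => _ [_ [H _]]; apply: H. Qed.
Lemma is_idealMl x y : I y -> I (x ** y). Proof. by case: iI => _ [_ [_ H]] /(H x) []. Qed.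
Lemma is_idealMr x y : I x -> I (x ** y). Proof. by case: iI => _ [_ [_ H]] /(H y) []. Qed.

Lemma is_ideal_sum (T : Type) (t : seq T) (f : T -> A) :
  (forall i, I (f i)) -> I (\sum_(i <- t) f i).
Proof.
move=> If; elim: t => [|i t IH]; first by rewrite big_nil; apply: is_ideal0.
by rewrite big_cons; apply: is_idealD.
Qed.

End Ideal.

Section Graded.
Variables (K : fieldType) (V Ed : Type) (s r : Ed -> V).
Variables (A : nualg K) (P : V -> A) (S St : Ed -> A).
Hypothesis LPA : is_leavitt_path_algebra s r A P S St.
Let LF : leavitt_family s r A P S St := LPA.1.
Local Notation monomial := (monomial s r P S St).
Local Notation graded := (is_graded_ideal s r P S St).
Local Notation sp := (spath P S).
Local Notation sg := (sghost P St).

Lemma homogP n x : homog s r P S St n x <-> lspan (monomial (degree n)) x.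
Proof.
split=> [[m [c [pv [qv [pl [ql [H ->]]]]]]]|].
  elim: (index_enum _) => [|i t IH]; first by rewrite big_nil; apply: span0.
  rewrite big_cons; apply: spanL => //; have [c1 [c2 [p12 sz]]] := H i.
  by exists (pv i), (qv i), (pl i), (ql i).
elim=> [|k y z [v [w [l [m [cl cm plm sz ->]]]]] _ [j [c [pv [qv [pl [ql [H ->]]]]]]]].
  have z0 T (i : 'I_0) : T by case: i.
  exists 0%N, (z0 _), (z0 _), (z0 _), (z0 _), (z0 _).
  by split=> [i|]; [case: (z0 False i) | rewrite big_ord0].
pose ext T (a : T) (b : 'I_j -> T) (i : 'I_j.+1) := if unlift ord0 i is Some i' then b i' else a.
exists j.+1, (ext _ k c), (ext _ v pv), (ext _ w qv), (ext _ l pl), (ext _ m ql); split.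
  by move=> i; rewrite /ext; case: unliftP => [i'|] _.
rewrite big_ord_recl /ext unlift_none; congr (_ + _).
by apply: eq_bigr => i _; rewrite liftK.
Qed.

Definition component : int -> A -> A := sval (cid (grading LPA)).

Lemma comp_linear n : is_linear (component n).
Proof. exact: (svalP (cid (grading LPA))).1. Qed.

Lemma compE n d x : lspan (monomial (degree d)) x -> component n x = if n == d then x else 0.
Proof. by move=> Mx; apply: (svalP (cid (grading LPA))).2. Qed.

Lemma comp_monomial n Q x : monomial Q x ->
  exists2 d : int, component n x = (if n == d then x else 0) & monomial (degree d) x.
Proof.
move=> [v [w [l [m [cl cm plm _ ->]]]]]; have Mx : monomial (degree ((size l)%:Z - (size m)%:Z)) (sp v l ** sg w m).
  by exists v, w, l, m.
by exists ((size l)%:Z - (size m)%:Z) => //; apply: compE; apply: span_gen.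
Qed.

Lemma comp_homog n x : lspan (monomial (degree n)) (component n x).
Proof.
apply: (span_linear (comp_linear n)) (spanning LPA x) => y /(comp_monomial n) [d -> My].
by case: eqP => [->|_]; [apply: span_gen | apply: span0].
Qed.

Lemma comp_sum x : exists D, x = \sum_(n <- D) component n x.
Proof.
have [|D [uD DP]] := span_resolution comp_linear _ (spanning LPA x).
  move=> y My; have [d _ Md] := comp_monomial 0 My.
  exists d; rewrite (compE _ (span_gen Md)) eqxx; split=> // n /eqP/negPf nd.
  by rewrite (compE _ (span_gen Md)) nd.
by exists D; apply: DP.
Qed.

(** Stability under the projections replaces the existential decomposition of [is_graded_ideal]; it
    passes easily to sums, intersections and spans of monomials. *)
Lemma graded_idealP I : graded I <-> is_ideal I /\ forall n x, I x -> I (component n x).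
Proof.
split=> [[iI gI]|[iI gI]]; split=> //; [move=> n x /gI|move=> x Ix].
  move=> [m [deg [y [Hy ->]]]]; rewrite (linear_sum _ _ (comp_linear n)).
  apply: is_ideal_sum => // i; have [Iy /homogP hy] := Hy i.
  by rewrite (compE _ hy); case: ifP => // _; apply: is_ideal0.
have [D ->] := comp_sum x.
exists (size D), (fun i => tnth (in_tuple D) i), (fun i => component (tnth (in_tuple D) i) x).
split; last by rewrite (big_tnth _ _ D).
by move=> i; split; [apply: gI | apply/homogP; apply: comp_homog].
Qed.

Lemma graded_zero : graded (fun x => x = 0).
Proof.
apply/graded_idealP; split=> [|n x ->]; last exact: linear0_of (comp_linear n).
split=> //; split=> [x y -> ->|]; first by rewrite addr0.
by split=> [k x ->|a x ->]; rewrite ?scaler0 ?nua_mul0 ?nua_0mul.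
Qed.

Lemma graded_full : graded (fun _ => True).
Proof. exact/graded_idealP. Qed.

Lemma graded_inter X Y : graded X -> graded Y -> graded (fun x => X x /\ Y x).
Proof.
move=> /graded_idealP [iX gX] /graded_idealP [iY gY]; apply/graded_idealP.
split=> [|n x [Xx Yx]]; last by split; [apply: gX|apply: gY].
split; first by split; apply: is_ideal0.
split=> [x y [Xx Yx] [Xy Yy]|]; first by split; apply: is_idealD.
split=> [k x [Xx Yx]|a x [Xx Yx]]; first by split; apply: is_idealZ.
by split; split; by [apply: is_idealMl|apply: is_idealMr].
Qed.

Definition ideal_add (X Y : A -> Prop) x := exists y z, [/\ X y, Y z & x = y + z].

Lemma graded_add X Y : graded X -> graded Y -> graded (ideal_add X Y).
Proof.
move=> /graded_idealP [iX gX] /graded_idealP [iY gY]; apply/graded_idealP.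
split=> [|n x [y [z [Xy Yz ->]]]]; last first.
  by exists (component n y), (component n z); split; [apply: gX|apply: gY|apply: (comp_linear n).1].
split; first by exists 0, 0; split; rewrite ?addr0 //; apply: is_ideal0.
split=> [x x' [y [z [Xy Yz ->]]] [y' [z' [Xy' Yz' ->]]]|].
  by exists (y + y'), (z + z'); split; [apply: is_idealD|apply: is_idealD|rewrite addrACA].
split=> [k x [y [z [Xy Yz ->]]]|a x [y [z [Xy Yz ->]]]].
  by exists (k *: y), (k *: z); split; [apply: is_idealZ|apply: is_idealZ|rewrite scalerDr].
split; first by exists (a ** y), (a ** z); split; [apply: is_idealMl|apply: is_idealMl|rewrite nua_mulDr].
by exists (y ** a), (z ** a); split; [apply: is_idealMr|apply: is_idealMr|rewrite nua_mulDl].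
Qed.

Lemma ideal_add_l X Y x : is_ideal Y -> X x -> ideal_add X Y x.
Proof. by move=> iY Xx; exists x, 0; split; rewrite ?addr0 //; apply: is_ideal0. Qed.

Lemma ideal_add_r X Y x : is_ideal X -> Y x -> ideal_add X Y x.
Proof. by move=> iX Yx; exists 0, x; split; rewrite ?add0r //; apply: is_ideal0. Qed.

Lemma graded_hereditary H : hereditary s r H -> graded (lspan (monomial (ending_in H))).
Proof.
move=> hH; apply/graded_idealP; split; last first.
  move=> n x; apply: (span_linear (comp_linear n)) => y My.
  have [d -> _] := comp_monomial n My.
  by case: ifP => _; [apply: span_gen | apply: span0].
split; first exact: span0.
split; first exact: span_add.
split; first exact: span_scale.
move=> a x Hx; split.
  apply: (span_linear (nua_linear_l x)) (spanning LPA a) => y My.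
  exact: (ideal_monomial_l LF).
apply: (span_linear (nua_linear_r x)) (spanning LPA a) => y My.
exact: (ideal_monomial_r LF).
Qed.

(** The algebra may lack a unit, but the sum of the finitely many vertices where the monomials of
    [x] start acts as one on [x]. *)
Lemma local_unit (x : A) : exists u, u ** x = x.
Proof.
have [||F [uF FP]] := span_resolution (T := {classic V}) (E := fun v x => P v ** x) _ _ (spanning LPA x).
- by move=> v; apply: nua_linear_r.
- move=> y [v [w [l [m [cl cm plm _ ->]]]]]; exists v; rewrite nua_mulA (P_spath LF) //.
  by split=> // t tv; rewrite nua_mulA (P_spath_neq LF) // nua_0mul.
by exists (\sum_(v <- F) P v); rewrite nua_mul_suml -FP.
Qed.

Definition complement (X Y : A -> Prop) : Prop :=
  (forall x, X x -> Y x -> x = 0) /\ forall x, ideal_add X Y x.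

(* A complemented ideal acts as a central idempotent: if [u = i + j] is a local
   unit of [m \in X], with [i \in X] and [j] in the complement, then [m = i m]. *)
Lemma boolean_complemented :
  is_boolean_algebra graded <-> forall X, graded X -> exists2 Y, graded Y & complement X Y.
Proof.
split=> [[_ [_ [_ [_ compl]]]] X gX|compl].
  have [Y [gY [glbY lubY]]] := compl X gX; exists Y => //.
  have gXY := graded_inter gX gY; have gaXY := graded_add gX gY.
  have [iX _] := gX; have [iY _] := gY.
  (* Intersection and sum are the meet and the join of [X] and [Y], so being bottom and top is
     comparable with the zero ideal and the whole algebra. *)
  have [_ bot] : is_bot graded (fun x => X x /\ Y x).
    apply: glbY; split=> //; split; first by move=> x [].
    by split=> [x []|W gW WX WY x Wx] //; split; [apply: WX|apply: WY].
  have [_ top] : is_top graded (ideal_add X Y).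
    apply: lubY; split=> //; split; first by move=> x; apply: ideal_add_l.
    split=> [x|W [iW _] XW YW x [y [z [Xy Yz ->]]]]; first exact: ideal_add_r.
    by apply: is_idealD => //; [apply: XW|apply: YW].
  by split=> [x Xx Yx|x]; [apply: (bot _ graded_zero) | apply: (top _ graded_full)].
split; first by exists (fun x => x = 0); split=> [|W [iW _] x ->]; [exact: graded_zero|exact: is_ideal0].
split; first by exists (fun _ => True); split=> //; exact: graded_full.
split=> [X Y gX gY|].
  have [iX _] := gX; have [iY _] := gY; split.
    exists (fun x => X x /\ Y x); split; first exact: graded_inter.
    split; first by move=> x [].
    by split=> [x []|W gW WX WY x Wx] //; split; [apply: WX|apply: WY].
  exists (ideal_add X Y); split; first exact: graded_add.
  split; first by move=> x; apply: ideal_add_l.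
  split=> [x|W [iW _] XW YW x [y [z [Xy Yz ->]]]]; first exact: ideal_add_r.
  by apply: is_idealD => //; [apply: XW|apply: YW].
split=> [X Y Z J M A1 B1 C gX gY gZ|X gX].
  move=> [gJ [YJ [ZJ minJ]]] [gM [MX [MJ maxM]]] [gA [AX [AY maxA]]] [gB [BX [BZ maxB]]].
  move=> [gC [AC [BC minC]]].
  have [[iX _] [iY _] [iZ _] [iC _]] := And4 gX gY gZ gC.
  split=> [m Mm|]; last first.
    apply: (minC M gM); first by apply: (maxM _ gA AX) => x /AY /YJ.
    by apply: (maxM _ gB BX) => x /BZ /ZJ.
  have [X' [iX' _] [dis cov]] := compl X gX.
  have Xm := MX m Mm; have [u um] := local_unit m.
  have [i [j [Xi Xj uij]]] := cov u.
  have im : m = i ** m.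
    have : j ** m = 0 by apply: dis; [apply: is_idealMl|apply: is_idealMr].
    by move=> jm; rewrite -[LHS]um uij nua_mulDl jm addr0.
  have [y [z [Yy Zz myz]]] : ideal_add Y Z m.
    apply: minJ (MJ _ Mm); first exact: graded_add.
      by move=> x; apply: ideal_add_l.
    by move=> x; apply: ideal_add_r.
  rewrite im myz nua_mulDr; apply: is_idealD => //.
    apply/AC/(maxA _ (graded_inter gX gY)) => [x []|x []|] //.
    by split; [apply: is_idealMr|apply: is_idealMl].
  apply/BC/(maxB _ (graded_inter gX gZ)) => [x []|x []|] //.
  by split; [apply: is_idealMr|apply: is_idealMl].
have [Y gY [dis cov]] := compl X gX; exists Y; split=> //; split=> [M [gM [MX [MY _]]]|J [gJ [XJ [YJ _]]]].
  split=> // W [iW _] x Mx; rewrite (dis x (MX x Mx) (MY x Mx)); exact: is_ideal0.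
split=> // W _ x _; have [y [z [Xy Yz ->]]] := cov x.
have [iJ _] := gJ; by apply: is_idealD => //; [apply: XJ|apply: YJ].
Qed.

End Graded.

(** * Nonzero graded ideals contain vertices *)

Section Reduction.
Variables (K : fieldType) (V Ed : Type) (s r : Ed -> V).
Variables (A : nualg K) (P : V -> A) (S St : Ed -> A).
Hypothesis LPA : is_leavitt_path_algebra s r A P S St.
Let LF : leavitt_family s r A P S St := LPA.1.
Local Notation monomial := (monomial s r P S St).
Local Notation graded := (is_graded_ideal s r P S St).
Local Notation sp := (spath P S).
Local Notation sg := (sghost P St).

(** [real d] allows only paths of length [d] without ghost part. In [ghost_le n d] the degree is
    [d], and [n] bounds the ghost length, which [reduction] brings down. *)
Local Notation real d := (fun a b _ => a = d /\ b = 0%N).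
Local Notation ghost_le n d := (fun a b _ => a%:Z - b%:Z = d /\ (b <= n)%N).

Lemma scale_vertex_neq0 c v : c <> 0 -> c *: P v <> 0.
Proof. by move=> /eqP c0 /eqP; rewrite scaler_eq0 (negPf c0) => /eqP; apply: (vertex_neq0 LPA). Qed.

Lemma left_vertex Q x : lspan (monomial Q) x -> x <> 0 -> exists v, P v ** x <> 0.
Proof.
apply: (span_resolution_neq0 (T := {classic V}) (E := fun v x => P v ** x)).
  by move=> v; apply: nua_linear_r.
move=> y [v [w [l [m [cl cm plm _ ->]]]]]; exists v; rewrite nua_mulA (P_spath LF) //.
by split=> // t tv; rewrite nua_mulA (P_spath_neq LF) // nua_0mul.
Qed.

Lemma right_vertex Q x : lspan (monomial Q) x -> x <> 0 -> exists v, x ** P v <> 0.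
Proof.
apply: (span_resolution_neq0 (T := {classic V}) (E := fun v x => x ** P v)).
  by move=> v; apply: nua_linear_l.
move=> y [v [w [l [m [cl cm plm _ ->]]]]]; exists w; rewrite -nua_mulA (sghost_P LF) //.
by split=> // t tv; rewrite -nua_mulA (sghost_P_neq LF) // nua_mul0.
Qed.

Lemma monomial_P_right Q v x : lspan (monomial Q) x -> lspan (monomial Q) (x ** P v).
Proof.
apply: (span_linear (nua_linear_l _)) => _ [u [w [l [m [cl cm plm Hl ->]]]]]; rewrite -nua_mulA.
have [->|vu] := pselect (v = w); last by rewrite (sghost_P_neq LF) // nua_mul0; apply: span0.
by rewrite (sghost_P LF) //; apply: span_gen; exists u, w, l, m.
Qed.

(** Ghost edges strip the leading edges of [x] one by one while keeping it nonzero. In length 0 a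
    combination of vertices remains, and a single [P v] isolates one term. *)
Lemma real_reduction d x : lspan (monomial (real d)) x -> x <> 0 ->
  exists v l c, [/\ chain s r v l, c <> 0 & sg v l ** x = c *: P (pend r v l)].
Proof.
elim: d x => [|d IH] x sx x0.
  have [v vx] := left_vertex sx x0.
  suff [c Ec] : exists c, P v ** x = c *: P v.
    exists v, [::], c; split=> //= c0; apply: vx; by rewrite Ec c0 scale0r.
  elim: sx {x0 vx} => [|k y z [u [w [l [m [cl cm plm [/size0nil l0 /size0nil m0] ->]]]]] _ [c Ec]].
    by exists 0; rewrite nua_mul0 scale0r.
  subst l m; rewrite /= in plm *; subst w; rewrite (PP LF) nua_mulDr nua_mulZr Ec.
  have [->|vu] := pselect (v = u); first by exists (k + c); rewrite (PP LF) scalerDl.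
  by exists c; rewrite (PP0 LF) // scaler0 add0r.
(* Each monomial has one leading edge, so the maps sending [x] to [S e ** (St e ** x)] resolve the
   identity and one of them does not kill [x]. *)
have [||e Ee] := span_resolution_neq0 (T := {classic Ed}) (E := fun e x => S e ** (St e ** x)) _ _ sx x0.
- move=> e; exact: is_linear_comp (nua_linear_r _) (nua_linear_r _).
- move=> _ [v [w [l [m [cl cm plm [Hl _] ->]]]]]; case: l cl plm Hl => // e l cl plm _; exists e.
  case: cl => _ cl; split=> [|t te]; rewrite (spath_cons LF) ![St _ ** _]nua_mulA.
    by rewrite (StS LF) (P_spath LF) // nua_mulA.
  by rewrite (StS0 LF) // !nua_0mul nua_mul0.
have sex : lspan (monomial (real d)) (St e ** x).
  apply: (span_linear (nua_linear_r _)) sx => _ [v [w [l [m [cl cm plm [Hl sm] ->]]]]].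
  case: l cl plm Hl => // f l cl plm [sl].
  rewrite (spath_cons LF) !nua_mulA; have [ef|ef] := pselect (e = f); last first.
    by rewrite (StS0 LF) // !nua_0mul; apply: span0.
  subst f; case: cl => _ cl; rewrite (StS LF) (P_spath LF) //.
  by apply: span_gen; exists (r e), w, l, m.
have [|v [l [c [cl c0 Ec]]]] := IH _ sex; first by move=> z; apply: Ee; rewrite z nua_mul0.
have vre : v = r e.
  apply: contrapT => vre; apply: (scale_vertex_neq0 (v := pend r v l) c0).
  rewrite -Ec -(PSt LF) -nua_mulA [sg v l ** _]nua_mulA (sghost_P_neq LF) ?nua_0mul //.
  by apply/nesym.
subst v; exists (s e), (e :: l), c; split=> //.
by rewrite (sghost_cons LF) -nua_mulA.
Qed.

Lemma ghost_le_S n d e x : lspan (monomial (ghost_le n.+1 d)) x ->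
  lspan (monomial (ghost_le n (d + 1))) (x ** S e).
Proof.
apply: (span_linear (nua_linear_l _)) => _ [u [w [l [[|f m] [cl cm plm [Hd Hn] ->]]]]]; rewrite -nua_mulA.
  rewrite /= in plm Hd *; have [ws|ws] := pselect (w = s e); last first.
    by rewrite (PS_neq LF) // nua_mul0; apply: span0.
  have cle : chain s r u (l ++ [:: e]) by apply/chain_cat; split=> //=; rewrite plm ws.
  apply: span_gen; exists u, (r e), (l ++ [:: e]), [::]; split=> //=.
  - by rewrite pend_cat.
  - by split=> //; rewrite size_cat /= PoszD -Hd !subr0.
  - by rewrite ws (PS LF) (spath_cat LF) //= -nua_mulA (SP LF).
have [ef|ef] := pselect (f = e); last first.
  by rewrite (sghost_cons LF) -nua_mulA (StS0 LF) // !nua_mul0; apply: span0.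
subst f; case: cm => _ cm; rewrite (sghost_cons LF) -nua_mulA (StS LF) (sghost_P LF) //.
apply: span_gen; exists u, (r e), l, m; split=> //; split=> //.
by rewrite -Hd /= -addn1 PoszD opprD addrA subrK.
Qed.

Definition ghost_tail (x : A) := exists f h, x = h ** St f.

Lemma real_ghost_split n d x : lspan (monomial (ghost_le n d)) x ->
  exists z y, [/\ x = z + y, lspan (monomial (ghost_le 0 d)) z & lspan ghost_tail y].
Proof.
elim=> [|k _ t [v [w [l [m [cl cm plm [Hd Hn] ->]]]]] _ [z [y [-> sz sy]]]].
  by exists 0, 0; split; rewrite ?addr0 //; apply: span0.
case: m cm plm Hd Hn => [|f m] cm plm Hd Hn.
  exists (k *: (sp v l ** sg w [::]) + z), y; split; rewrite ?addrA //.
  by apply: spanL => //; exists v, w, l, [::].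
exists z, (k *: (sp v l ** sg w (f :: m)) + y); split=> //; first by rewrite addrCA.
apply: spanL => //; exists f, (sp v l ** sg (r f) m).
by rewrite (sghost_cons LF) nua_mulA.
Qed.

Lemma ghost_tail_P v y : lspan ghost_tail y -> lspan ghost_tail (y ** P v).
Proof.
apply: (span_linear (nua_linear_l _)) => _ [f [h ->]]; rewrite -nua_mulA.
have [->|vs] := pselect (v = s f); first by rewrite (StP LF); apply: span_gen; exists f, h.
by rewrite (StP_neq LF) // nua_mul0; apply: span0.
Qed.

Lemma ghost_tail_resolution y : lspan ghost_tail y ->
  exists F : seq Ed, y = \sum_(f <- F) y ** S f ** St f.
Proof.
move=> sy.
have [||F [uF FP]] := span_resolution (T := {classic Ed}) (E := fun f x => x ** S f ** St f) _ _ sy.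
- move=> e; exact: is_linear_comp (nua_linear_l _) (nua_linear_l _).
- move=> _ [f [h ->]]; exists f; split=> [|t tf]; rewrite -(nua_mulA h).
    by rewrite (StS LF) -nua_mulA (PSt LF).
  by rewrite (StS0 LF) ?nua_mul0 ?nua_0mul //; apply/nesym.
by exists F; apply: FP.
Qed.

(** If some [x ** P w ** S e] is nonzero, its ghost parts are shorter and induction applies. If all
    vanish, (CK2) makes [w] non-regular, and [x ** P w] splits into a real part and a part ending in
    ghost edges. The real part is nonzero and reduces to a multiple of [P w]; it remains to kill the
    other part. *)
Lemma reduction n d x : lspan (monomial (ghost_le n d)) x -> x <> 0 ->
  exists y z c w, c <> 0 /\ y ** x ** z = c *: P w.
Proof.
have base x' d' : lspan (monomial (ghost_le 0 d')) x' -> x' <> 0 ->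
  exists v l c, [/\ chain s r v l, c <> 0 & sg v l ** x' = c *: P (pend r v l)].
  case: d' => d' sx x0.
    apply: (real_reduction (d := d')) x0; apply: span_sub sx => y [v [w [l [m [cl cm plm [Hd Hm] ->]]]]].
    move: Hm Hd; rewrite leqn0 => /eqP m0; rewrite m0 subr0 => -[l0].
    by exists v, w, l, m.
  (* Without ghost part no monomial has negative degree, so [x'] would be 0. *)
  case: x0; elim: sx => // k y z [v [w [l [m [_ _ _ [Hd Hm] _]]]]].
  by move: Hm Hd; rewrite leqn0 => /eqP ->; rewrite subr0.
elim: n d x => [|n IH] d x sx x0.
  have [v [l [c [cl c0 Ec]]]] := base _ _ sx x0.
  by exists (sg v l), (P (pend r v l)), c, (pend r v l); split=> //; rewrite Ec nua_mulZl (PP LF).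
have [w xw0] := right_vertex sx x0.
have [[e xe0]|xe0] := pselect (exists e, x ** P w ** S e <> 0).
  have [y [z [c [u [c0 Ec]]]]] := IH _ _ (ghost_le_S e (monomial_P_right w sx)) xe0.
  by exists y, (P w ** (S e ** z)), c, u; split=> //; rewrite -Ec !nua_mulA.
have {}xe0 e : x ** P w ** S e = 0 by apply: contrapT => xe; apply: xe0; exists e.
have nrw : ~ regular s w.
  move=> [l El l0]; apply: xw0.
  rewrite -(PP LF) nua_mulA [X in _ ** X = _](CK2 LF El l0) nua_mul_sumr big1 // => e _.
  by rewrite nua_mulA xe0 nua_0mul.
have [z0 [y0 [x_zy sz0 sy0]]] := real_ghost_split sx.
have xwE : x ** P w = z0 ** P w + y0 ** P w by rewrite x_zy nua_mulDl.
have sz := monomial_P_right w sz0; have [F EF] := ghost_tail_resolution (ghost_tail_P w sy0).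
(* Otherwise [x ** P w] would be its own ghost part, a sum of terms [x ** P w ** S f ** St f], all
   zero. *)
have zn0 : z0 ** P w <> 0.
  move=> z0w; rewrite z0w add0r in xwE; apply: xw0; rewrite xwE EF big1 // => f _.
  by rewrite -xwE xe0 nua_0mul.
have [v [l [c [cl c0 Ec]]]] := base _ _ sz zn0.
have pw : pend r v l = w.
  apply: contrapT => pw; apply: (scale_vertex_neq0 (v := pend r v l) c0).
  by rewrite -Ec -(PP LF w) (nua_mulA z0) nua_mulA Ec nua_mulZl (PP0 LF) // scaler0.
suff yw0 : y0 ** P w = 0.
  by exists (sg v l), (P w), c, (pend r v l); split=> //; rewrite -nua_mulA xwE yw0 addr0.
(* A non-infinite emitter that is not regular is a sink, so every term of [EF] vanishes. *)
have [inf|ninf] := pselect (infinite_emitter s w); last first.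
  have [m Em] := not_infinite_emitter ninf.
  have m0 : m = [::] by apply: contrapT => m0; apply: nrw; exists m.
  rewrite EF big1 // => f _; rewrite -(nua_mulA _ (P w)) (PS_neq LF) ?nua_mul0 ?nua_0mul // => wf.
  by have := (Em.2 f).1 (esym wf); rewrite m0.
(* At an infinite emitter some edge [e] avoids the finitely many final ghost edges, so it kills the
   ghost part. Then it also kills the real part, although that reduces to a nonzero multiple of
   [P w], and [P w ** S e] is not 0. *)
have [e [sew eF]] : exists e, s e = w /\ ~ List.In e F.
  apply: contrapT => ne; apply: inf; exists F => e sew; apply: contrapT => eF.
  by apply: ne; exists e.
have ye0 : y0 ** P w ** S e = 0.
  rewrite EF nua_mul_suml; elim: F {EF} eF => [|f F IHF] eF; first by rewrite big_nil.
  rewrite big_cons IHF; last by move=> eF'; apply: eF; right.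
  by rewrite -nua_mulA (StS0 LF) ?nua_mul0 ?addr0 // => fe; apply: eF; left.
have ze0 : z0 ** P w ** S e = 0 by have := xe0 e; rewrite xwE nua_mulDl ye0 addr0.
case: (scale_vertex_neq0 (v := r e) c0); rewrite -(StS LF) -nua_mulZr -(PS LF) sew.
by rewrite -pw -nua_mulZl -Ec -nua_mulA ze0 !nua_mul0.
Qed.

(** A nonzero homogeneous component of [x] stays in [I] by gradedness; it has bounded ghost length,
    so [reduction] turns it into a nonzero multiple of a vertex. *)
Lemma graded_ideal_vertex I x : graded I -> I x -> x <> 0 -> exists w, I (P w).
Proof.
move=> /(graded_idealP LPA) [iI gI] Ix x0.
have [n cn0] : exists n, component LPA n x <> 0.
  apply: contrapT => nc; apply: x0; have [D ->] := comp_sum LPA x.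
  by rewrite big1 // => n _; apply: contrapT => cn; apply: nc; exists n.
have [N sN] : exists N, lspan (monomial (ghost_le N n)) (component LPA n x).
  elim: (comp_homog LPA n x) => [|k y z [v [w [l [m [cl cm plm sz ->]]]]] _ [N sN]].
    by exists 0%N; apply: span0.
  exists (maxn (size m) N); apply: spanL.
    by exists v, w, l, m; split=> //; split=> //; apply: leq_maxl.
  apply: span_sub sN => _ [v' [w' [l' [m' [cl' cm' plm' [sz' le'] ->]]]]].
  by exists v', w', l', m'; split=> //; split=> //; rewrite leq_max le' orbT.
have [y [z [c [w [/eqP c0 Ec]]]]] := reduction sN cn0.
exists w; rewrite -[P w]scale1r -(mulVf c0) -scalerA -Ec.
by apply: (is_idealZ iI); apply: (is_idealMr iI); apply: (is_idealMl iI); apply: gI.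
Qed.

Lemma vertex_hereditary I : is_ideal I -> hereditary s r (fun v => I (P v)).
Proof.
move=> iI e Ie; rewrite -(StS LF) -(PS LF).
by apply: (is_idealMl iI); apply: (is_idealMr iI).
Qed.

Lemma vertex_saturated I : is_ideal I -> saturated s r (fun v => I (P v)).
Proof.
move=> iI v [l El l0] Ir; rewrite (CK2 LF El l0).
have := fun e => (El.2 e).2; elim: l {l0 El} => [|e l IH] Hl; first by rewrite big_nil; apply: is_ideal0.
rewrite big_cons; apply: is_idealD => //; last by apply: IH => f fl; apply: Hl; right.
rewrite -(SP LF) -nua_mulA; apply: (is_idealMl iI); apply: (is_idealMr iI); apply: Ir.
by apply: Hl; left.
Qed.

Lemma all_vertices I : is_ideal I -> (forall v, I (P v)) -> forall x, I x.
Proof.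
move=> iI Iv x; elim: (spanning LPA x) => [|k y z [v [w [l [m [cl _ _ _ ->]]]]] _ Iz].
  exact: is_ideal0.
apply: is_idealD => //; apply: is_idealZ => //; apply: is_idealMr => //.
by rewrite -(P_spath LF) //; apply: is_idealMr.
Qed.

Lemma vertex_in_span H v : H v -> lspan (monomial (ending_in H)) (P v).
Proof. by move=> Hv; apply: span_gen; exists v, v, [::], [::]; split=> //=; rewrite (PP LF). Qed.

Lemma reflexive_complemented : all_reflexive s r ->
  forall X, graded X -> exists2 Y, graded Y & complement X Y.
Proof.
move=> Er X gX; have [iX _] := gX.
pose H v := X (P v); pose H' v := ~ exists2 h, H h & reaches s r v h.
have hH : hereditary s r H by apply: vertex_hereditary.
have hH' : hereditary s r H'.
  move=> e H'e [h Hh reh]; apply: H'e; exists h => //.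
  exact: reaches_trans (reaches_edge _ _ e) reh.
pose Y := lspan (monomial (ending_in H')).
have gY : graded Y by apply: graded_hereditary.
have [iY _] := gY; have iXY : is_ideal (ideal_add X Y) by case: (graded_add LPA gX gY).
exists Y => //; split; last first.
  apply: all_vertices => //; apply: (reflexive_cover Er hH).
  - exact: vertex_hereditary.
  - exact: vertex_saturated.
  - by move=> v; apply: ideal_add_l.
  - by move=> v H'v; apply: ideal_add_r => //; apply: vertex_in_span.
move=> x Xx Yx; apply: contrapT => x0.
have [//|w [Xw Yw]] := graded_ideal_vertex (graded_inter LPA gX gY) _ x0.
apply: (vertex_neq0 (v := w) LPA); rewrite -(PP LF).
(* Left multiplication by [P w] kills [Y]: a monomial of [Y] starting at [w] would end at a vertex
   that does not reach [H], yet [w] is in the hereditary set [H]. *)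
apply: (span_linear0 (nua_linear_r (P w))) Yw => _ [v [u [l [m [cl _ _ Hl ->]]]]].
rewrite nua_mulA; have [wv|wv] := pselect (w = v); last by rewrite (P_spath_neq LF) // nua_0mul.
subst v; case: Hl; exists (pend r w l); last exact: reaches_refl.
exact: hereditary_reaches hH Xw (reaches_pend cl).
Qed.

Definition comparable_paths l m : Prop := (exists k : seq Ed, m = l ++ k) \/ (exists k, l = m ++ k).

(** Write [P v] as [i + j]. The list [F] holds the real paths from [v] in the monomials of [i].
    Compressing by [m] turns [P v] into the range vertex of [m], sends [j] into [Y], and kills [i]
    unless [m] is comparable with a path in [F]. *)
Lemma complement_paths H Y v : hereditary s r H -> is_ideal Y ->
  complement (lspan (monomial (ending_in H))) Y ->
  exists F : seq (seq Ed), (forall l, List.In l F -> chain s r v l /\ H (pend r v l)) /\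
    forall m, chain s r v m ->
      Y (P (pend r v m)) \/ exists2 l, List.In l F & comparable_paths l m.
Proof.
move=> hH iY [_ cov]; have [i [j [Hi Yj Pij]]] := cov (P v).
suff [F [FH FP]] : exists F : seq (seq Ed), (forall l, List.In l F -> chain s r v l /\ H (pend r v l)) /\
    forall m, chain s r v m -> sg v m ** i ** sp v m = 0 \/ exists2 l, List.In l F & comparable_paths l m.
  exists F; split=> // m cm; have [mi|] := FP m cm; [left|by right].
  rewrite -(sghost_spath LF) // -(P_spath LF) // nua_mulA Pij nua_mulDr nua_mulDl mi add0r.
  by apply: is_idealMr => //; apply: is_idealMl.
elim: Hi {Pij Yj} => [|k _ z [u [w [l [n [cl cn pln Hl ->]]]]] _ [F [FH FP]]].
  by exists [::]; split=> // m cm; left; rewrite nua_mul0 nua_0mul.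
have [uv|uv] := pselect (u = v); last first.
  exists F; split=> // m cm; have [z0|] := FP m cm; [left|by right].
  rewrite nua_mulDr nua_mulDl z0 nua_mulZr nua_mulA (sghost_spath_neq LF) //; last exact/nesym.
  by rewrite nua_0mul scaler0 nua_0mul addr0.
subst u; exists (l :: F); split=> [l' [<-//|/FH //]|m cm].
have [z0|[l' Fl' cmp]] := FP m cm; last by right; exists l' => //; right.
have [lm|lm] := pselect (comparable_paths l m); first by right; exists l => //; left.
left; rewrite nua_mulDr nua_mulDl z0 nua_mulZr nua_mulA.
have -> : sg v m ** sp v l = 0.
  by apply: contrapT => /(sghost_spath_comparable LF cm cl) [?|?]; apply: lm; [right|left].
by rewrite nua_0mul scaler0 nua_0mul addr0.
Qed.

End Reduction.

(** * From complements to all-reflexivity *)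

Section Converse.
Variables (K : fieldType) (V Ed : Type) (s r : Ed -> V).
Variables (A : nualg K) (P : V -> A) (S St : Ed -> A).
Hypothesis LPA : is_leavitt_path_algebra s r A P S St.
Let LF : leavitt_family s r A P S St := LPA.1.
Local Notation graded := (is_graded_ideal s r P S St).
Hypothesis compl : forall X, graded X -> exists2 Y, graded Y & complement X Y.

(** If the range of [m] lies in [Y] and reaches [h] in [H], then [P h] lies in both complementary
    ideals, contradicting [vertex_neq0]. *)
Lemma complement_dichotomy H v : hereditary s r H ->
  exists F : seq (seq Ed), (forall l, List.In l F -> chain s r v l /\ H (pend r v l)) /\
    forall m, chain s r v m ->
      (forall h, H h -> ~ reaches s r (pend r v m) h) \/
      exists2 l, List.In l F & comparable_paths l m.
Proof.
move=> hH; have [Y [iY gY] cY] := compl (graded_hereditary LPA hH).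
have [F [FH FP]] := complement_paths LPA v hH iY cY.
exists F; split=> // m cm; have [Ym|?] := FP m cm; [left|by right] => h Hh mh.
apply: (vertex_neq0 (v := h) LPA); apply: cY.1; first exact: vertex_in_span.
by apply: (hereditary_reaches (vertex_hereditary LPA iY) Ym mh).
Qed.

(** Such an edge, as a path of length one, is comparable with a path of [F]. That path is nonempty
    since [v] is not in [H], so it begins with the edge. *)
Lemma finitely_many_entries H v : hereditary s r H -> ~ H v ->
  finite_pred (fun e => s e = v /\ H (r e)).
Proof.
move=> hH nHv; have [F [FH FP]] := complement_dichotomy v hH.
exists (flatten F) => e [sev Hre].
have [/(_ _ Hre)[]|[l Fl cmp]] := FP [:: e] (conj sev I); first exact: reaches_refl.
have el : List.In e l.
  case: l Fl cmp => [/FH [_ /nHv]//|f l _].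
  by case=> [[k [<- _]]|[k [<- _]]]; left.
elim: F {FH FP} Fl => //= l' F IH Fl; apply/List.in_app_iff.
by case: Fl => [->|/IH]; [left|right].
Qed.

Lemma inf_path_prefix a n : is_inf_path s r a ->
  chain s r (s (a 0%N)) (mkseq a n) /\ pend r (s (a 0%N)) (mkseq a n) = s (a n).
Proof.
move=> pa; elim: n => [|n [cn pn]]; first by [].
by rewrite mkseqS -cats1 chain_cat pend_cat pn /= pa.
Qed.

(** A prefix longer than every path of [F] can be comparable only with a path that it extends; the
    end of that path would be a vertex of [a] in [H]. *)
Lemma inf_path_escapes H a : hereditary s r H -> is_inf_path s r a ->
  (forall n, ~ H (s (a n))) ->
  exists N, forall n, (N <= n)%N -> forall h, H h -> ~ reaches s r (s (a n)) h.
Proof.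
move=> hH pa nHa; have [F [FH FP]] := complement_dichotomy (s (a 0%N)) hH.
have [N NP] : exists N, forall l, List.In l F -> (size l < N)%N.
  elim: F {FH FP} => [|l F [N NP]]; first by exists 0%N.
  exists (maxn (size l).+1 N) => l' /= [<-|/NP lN]; first exact: leq_maxl.
  exact: leq_trans lN (leq_maxr _ _).
exists N => n Nn; have [cn pn] := inf_path_prefix n pa.
have [esc|[l Fl cmp]] := FP _ cn; first by rewrite -pn.
have ln : (size l < n)%N := leq_trans (NP l Fl) Nn.
case: cmp => [[k Ek]|[k Ek]]; last first.
  by move: ln; rewrite Ek size_cat size_mkseq ltnNge leq_addr.
case: (nHa (size l)); have [_ Hl] := FH l Fl.
suff El : l = mkseq a (size l) by have [_ <-] := inf_path_prefix (size l) pa; rewrite -El.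
have El : take (size l) (mkseq a n) = l by rewrite Ek take_size_cat.
by rewrite -[LHS]El /mkseq -map_take take_iota (minn_idPl (ltnW ln)).
Qed.

Lemma cycle_inf_path c v : is_cycle s r c -> on_cycle s c v ->
  exists a, [/\ is_inf_path s r a, s (a 0%N) = v & forall n, on_cycle s c (s (a n))].
Proof.
move=> cc vc; have [u|nxt nxtP] := @choice V Ed
    (fun u e => on_cycle s c u -> s e = u /\ on_cycle s c (r e)).
  have [uc|uc] := pselect (on_cycle s c u); last first.
    by move: vc => /List.in_map_iff [e _]; exists e.
  move: (uc) => /List.in_map_iff [e [seu ec]]; exists e => _; split=> //.
  exact: cycle_edge cc ec.
pose x n := iter n (fun u => r (nxt u)) v.
have xc n : on_cycle s c (x n) by elim: n => //= n /nxtP [].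
have sx n : s (nxt (x n)) = x n by case: (nxtP _ (xc n)).
by exists (fun n => nxt (x n)); split=> [n||n]; rewrite sx.
Qed.

Lemma inf_path_vertexP a v : is_inf_path s r a -> inf_path_vertices s r a v ->
  exists n, s (a n) = v.
Proof. by move=> pa [n [|]]; [exists n | exists n.+1; rewrite -pa]. Qed.

Lemma complemented_reflexive : all_reflexive s r.
Proof.
split=> [c cc|]; last split=> [v inf|a pa].
(* Clause (a): take for [H] the descendants of the end of a path that never returns to the cycle.
   Running round the cycle stays off [H] but can always reach it. *)
- apply: contrapT => /not_orP [/contrapT ex next]; apply: next; split=> // v l vc cl.
  apply: contrapT => nret; pose H := descendants s r (fun w => w = pend r v l).
  have hH : hereditary s r H by apply: hereditary_descendants.
  have [a [pa a0 ac]] := cycle_inf_path cc vc.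
  have [|N NP] := inf_path_escapes hH pa.
    by move=> n [w -> wa]; apply: nret; exists (s (a n)).
  apply: (NP N (leqnn N) (pend r v l)); first by exists (pend r v l) => //; apply: reaches_refl.
  exact: reaches_trans (cycle_reaches cc (ac N) vc) (reaches_pend cl).
(* Clause (b): take for [H] the vertices reached from [v] by paths of positive length. Either [v] is
   among them and lies on a cycle, or all edges at [v] enter [H] and are finite in number. *)
- apply: contrapT => nc; pose H := descendants s r (fun w => exists2 e, s e = v & w = r e).
  have hH : hereditary s r H by apply: hereditary_descendants.
  have [|L LP] := @finitely_many_entries H v hH.
    move=> [_ [e sev ->] [l [cl pl]]]; apply: nc.
    have [c cc vc] : exists2 c, is_cycle s r c & on_cycle s c v.
      by apply: (closed_path_cycle (l := e :: l)).
    by exists c.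
  apply: inf; exists L => e sev; apply: LP; split=> //.
  by exists (r e); [exists e|apply: reaches_refl].
(* Clause (c): take for [H] the descendants of the ranges of the offending edges. The path avoids
   [H] and from index [N] on cannot reach it, so these edges start at one of the first [N] sources,
   each having finitely many entries into [H]. *)
pose X := inf_path_vertices s r a.
pose H := descendants s r (fun w => exists e, [/\ X (s e), ~ RR s r X (r e) & w = r e]).
have hH : hereditary s r H by apply: hereditary_descendants.
have nHa n : ~ H (s (a n)).
  move=> [_ [e [_ nR ->]] re]; apply: nR; exists (s (a n)); split=> //.
  by exists n; left.
have [N NP] := inf_path_escapes hH pa nHa.
have [L LP] : finite_pred (fun e => exists2 m, (m < N)%N & s e = s (a m) /\ H (r e)).
  elim: N {NP} => [|N [L LP]]; first by exists [::] => e [].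
  have [L' LP'] := finitely_many_entries hH (nHa N).
  exists (L ++ L') => e [m]; rewrite ltnS leq_eqVlt => /orP [/eqP ->|mN] He.
    by apply/List.in_app_iff; right; apply: LP'.
  by apply/List.in_app_iff; left; apply: LP; exists m.
exists L => e [Xe nRe]; apply: LP; have [m am] := inf_path_vertexP pa Xe.
have Hre : H (r e) by exists (r e); [exists e|apply: reaches_refl].
exists m => //; rewrite ltnNge; apply/negP => /NP /(_ _ Hre); apply.
by rewrite am; apply: reaches_edge.
Qed.

End Converse.

Theorem theorem3p15 (K : fieldType) (V Ed : Type) (s r : Ed -> V)
  (A : nualg K) (P : V -> A) (S St : Ed -> A) :
  is_leavitt_path_algebra s r A P S St ->
  (all_reflexive s r <->
   is_boolean_algebra (is_graded_ideal s r P S St)).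
Proof.
move=> LPA; split=> [Er|/(boolean_complemented LPA) compl].
  by apply/(boolean_complemented LPA); apply: reflexive_complemented.
exact: complemented_reflexive compl.
Qed.
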